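(* Consider the regular Poisson tree generalized random energy model with parameters $k(1,N),\dots,k(n,N)$ and weights $a_1,\dots,a_n>0$ described in the context, with $\frac{k(i,N)}N\to p_i>0$ for $1\le i\le n$. Suppose that for each $i$, $1\le i\le n$, the laws (indexed by $N$) of $\frac{\xi(\sigma_1\cdots\sigma_i)}N$ satisfy the large deviation principle with a good, strictly quasi-convex rate function $\mathcal{I}_i$. Then for almost every tree sequence, almost surely, for $\beta>0$, $$\lim_{N\to\infty}\frac1N\log Z_N(\beta)=\log2-\inf_{\widetilde x\in\Psi}\left\{\sum_{i=1}^n\left(\mathcal{I}_i(x_i)-\beta a_ix_i\right)\right\},$$ where $$\Psi=\left\{\widetilde x=(x_1,\dots,x_n)\in\mathbb{R}^n:\ \sum_{i=1}^k\mathcal{I}_i(x_i)\le\sum_{i=1}^kp_i\log2,\ 1\le k\le n\right\}.$$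
   Context: Model: fix $n\ge1$; for each $N\ge n$ let $k(1,N),\dots,k(n,N)$ be positive integers with sum $N$. For each $N$ let $L_{1N},\dots,L_{nN}$ be independent random variables, $L_{iN}$ Poisson with parameter $2^{k(i,N)}$. The random tree for $N$ has $n$ levels and $1+L_{iN}$ nodes at level $i$ below each node of level $i-1$ (so $\prod_i(1+L_{iN})$ branches). Nodes of level $i$ are denoted $\sigma_1\cdots\sigma_i$; the configurations are the branches $\sigma=\sigma_1\cdots\sigma_n$. To each node $\sigma_1\cdots\sigma_i$ is attached a symmetric real random variable $\xi(\sigma_1\cdots\sigma_i)$; for fixed $N$ all these are independent, those at the same level $i$ have the same law (depending on $i$ and $N$), and they are independent of the tree randomness. The Hamiltonian is $H_N(\sigma)=\sum_{i=1}^na_i\xi(\sigma_1\cdots\sigma_i)$ and $Z_N(\beta)=\sum_\sigma e^{-\beta H_N(\sigma)}$, the sum over all branches. ''For almost every tree sequence, almost surely'' means: for almost every realization of the trees $(T_N)_N$, with probability one with respect to the $\xi$'s. LDP: probability measures $\{\nu_N\}$ on $\mathbb{R}$ satisfy the LDP with rate function $\mathcal{I}:\mathbb{R}\to[0,\infty]$ (lower semicontinuous) if $-\inf_{B^0}\mathcal{I}\le\liminf_N\frac1N\log\nu_N(B)\le\limsup_N\frac1N\log\nu_N(B)\le-\inf_{\overline B}\mathcal{I}$ for all Borel $B$; good means compact level sets $\{\mathcal{I}\le a\}$, $a<\infty$. Strictly quasi-convex: $f(\theta x+(1-\theta)y)<\max\{f(x),f(y)\}$ for distinct $x,y\in\{f<\infty\}$,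 $\theta\in(0,1)$. *)

(* Defs.v *)
From HB Require Import structures.
From mathcomp Require Import all_boot all_order all_algebra.
From mathcomp Require Import all_classical all_reals all_analysis.
Set Implicit Arguments.
Unset Strict Implicit.
Unset Printing Implicit Defensive.
Import Order.TTheory GRing.Theory Num.Theory.
Import numFieldNormedType.Exports.
Local Open Scope classical_set_scope.
Local Open Scope ring_scope.

Section Probability.
Context d (T : measurableType d) (R : realType) (P : probability T R).

(* Independence of the subfamily indexed by D; the probabilities on the right
   are finite, so the product is taken in R. *)
Definition mutually_independent d' (U : measurableType d') (J : eqType)
    (D : set J) (X : J -> {RV P >-> U}) : Prop :=
  forall (s : seq J) (A : J -> set U),
    uniq s -> [set` s] `<=` D -> (forall j, measurable (A j)) ->
    P (\bigcap_(j in [set` s]) (X j @^-1` A j))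
      = (\prod_(j <- s) fine (P (X j @^-1` A j)))%:E.

(* Equality of laws is only required on measurable sets, since a measure takes
   unspecified values elsewhere. *)
Definition same_law d' (U : measurableType d') (X Y : {RV P >-> U}) : Prop :=
  forall A : set U, measurable A -> distribution P X A = distribution P Y A.

Definition symmetric_rv (X : {RV P >-> R}) : Prop :=
  forall A : set R, measurable A ->
    P [set w | A (X w)] = P [set w | A (- X w)].

Definition poisson_rv (X : {RV P >-> nat}) (rate : R) : Prop :=
  forall j : nat, P [set w | X w = j] = (poisson_pmf rate j)%:E.

End Probability.

Section LargeDeviations.
Context (R : realType).
Local Open Scope ereal_scope.

Definition rate_function (I : R -> \bar R) : Prop :=
  (forall x, 0 <= I x) /\ lower_semicontinuous I.

Definition good (I : R -> \bar R) : Prop :=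
  forall c : R, compact [set x | I x <= c%:E].

Definition strictly_quasi_convex (I : R -> \bar R) : Prop :=
  forall (x y t : R), x != y -> I x < +oo -> I y < +oo ->
    (0 < t < 1)%R -> I (t * x + (1 - t) * y)%R < maxe (I x) (I y).

(* lne 0 = -oo, so sets of measure zero are covered; the term N = 0 is
   irrelevant to the limits. *)
Definition ldp (nu : nat -> probability R R)
    (I : R -> \bar R) : Prop :=
  rate_function I /\
  forall B : set R, measurable B ->
    let u := fun N : nat => (N%:R^-1)%:E * lne (nu N B) in
    [/\ - ereal_inf [set I x | x in interior B] <= limn_einf u,
        limn_einf u <= limn_esup u &
        limn_esup u <= - ereal_inf [set I x | x in closure B]].

End LargeDeviations.

Section Tree.
Context (R : realType) (n : nat).

(* Levels are numbered from 0, so level i : 'I_n is the (i+1)-st level.  In the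
   regular tree where every node of the previous level has 1 + l i children at
   level i, a branch chooses one of the 1 + l i children at each level. *)
Local Notation branch l := {dffun forall i : 'I_n, 'I_(l i).+1}.

(* The node of the branch at level i, as the word of length i+1 of the choices
   made at levels 0, ..., i. *)
Definition node (l : 'I_n -> nat) (sigma : branch l) (i : 'I_n) : seq nat :=
  [seq nat_of_ord (sigma j) | j : 'I_n <- enum 'I_n & (j <= i)%N].

Definition hamiltonian (a : 'I_n -> R) (xi : seq nat -> R) (l : 'I_n -> nat)
    (sigma : branch l) : R :=
  \sum_(i < n) a i * xi (node sigma i).

Definition partition_function (a : 'I_n -> R) (xi : seq nat -> R)
    (l : 'I_n -> nat) (beta : R) : R :=
  \sum_(sigma : branch l) expR (- beta * hamiltonian a xi sigma).

Definition Psi (p : 'I_n -> R) (I : 'I_n -> R -> \bar R) : set 'rV[R]_n :=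
  [set x | forall k : 'I_n,
    (\sum_(i < n | (i <= k)%N) I i (x ord0 i)
      <= (\sum_(i < n | (i <= k)%N) p i * ln 2)%:E)%E].

End Tree.

(* Main.v *)
Require Import Defs.
From HB Require Import structures.
From mathcomp Require Import all_boot all_order all_algebra.
From mathcomp Require Import all_classical all_reals all_analysis.
From mathcomp Require Import ring lra measurable_realfun.
Import Order.TTheory GRing.Theory Num.Theory.
Import numFieldNormedType.Exports.
Local Open Scope classical_set_scope.
Local Open Scope ring_scope.

(** Replace each energy by the rescaled variable X = - xi / N, which by symmetry
    has the law of xi / N, so that the partition function is the sum over the
    branches of exp (N beta (a_1 X_1 + ... + a_n X_n)).  The theorem is a
    Laplace principle for this sum, once the number of branches whose X_i lie
    in given sets B_i is known on the exponential scale.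

    Put h_i = p_i ln 2 and J_i = inf of I_i over B_i.  A node of level i - 1 has
    exp (N h_i) children up to subexponential factors (ae_poisson_growth, from
    Chernoff bounds for the Poisson law), and a node of level i falls in B_i with
    probability about exp (- N J_i).  Hence the expected number of good prefixes
    of length k is about exp (N S_k), where S_k is the sum over i <= k of
    h_i - J_i.  Three estimates follow, the first
    two for closed B_i and the third for open B_i.
    - If S_k < 0 for some k, then almost surely there is eventually no good
      prefix of length k, hence no good branch (cell_dead).
    - If all the J_i are finite, then the number of good branches is eventually
      at most exp (N (S_n + e)), by the Markov inequality (cell_alive).
    - If S_k > 0 for all k, then it is eventually at least exp (N (S_n - e)), by
      the Chebyshev inequality (cell_open).  Two branches with exactly k common
      levels are correlated, but such pairs add to the second moment only a
      fraction exp (- N S_k) of the squared mean (count_lower_bound).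

    In each case the exceptional events have exponentially small probability, so
    the first Borel-Cantelli lemma applies whatever the dependence between
    different values of N.  The exceptional null set must not depend on beta:
    only countably many products of sets are used, the cells of a sequence of
    finer and finer finite grids on a cube which, almost surely, contains all
    the rescaled energies for large N.

    The upper bound on the partition function adds up the contributions of the
    closed cells.  For a cell with S_k >= 0 for all k, goodness provides a point
    of the cell where all the I_i attain their infimum over it; this point is in
    Psi, and the exponent of the contribution of the cell exceeds ln 2 minus the
    objective at this point by at most a multiple of the mesh.  The lower bound
    uses one open cell around a point of Psi, which must satisfy all the
    constraints strictly.  Such points come arbitrarily close to the infimum: move
    an almost optimal point of Psi slightly towards the point x0 where all the I_i
    vanish.  By strict quasi-convexity every rate I_i(x_i) with x_i different from
    x0_i decreases, and if none of the first k does then the k-th constraint reads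
    0 < h_1 + ... + h_k (strictly_admissible_near_optimal). *)

Set Implicit Arguments.
Unset Strict Implicit.
Unset Printing Implicit Defensive.

(** * Consequences of a large deviation principle *)

Section LDP.
Context (R : realType).
Implicit Types (I : R -> \bar R) (B : set R).

Lemma ldp_upper (nu : nat -> probability R R) I B (c : R) :
  ldp nu I -> closed B -> (c%:E < ereal_inf [set I x | x in B])%E ->
  \forall N \near \oo, fine (nu N B) <= expR (- (c * N%:R)).
Proof.
move=> [_ hI] cB hc.
have mB : measurable B by exact: closed_measurable.
have [_ _ +] := hI B mB.
rewrite -(closure_id B).1// => hle.
have : (limn_esup (fun N : nat => (N%:R^-1)%:E * lne (nu N B)) < (- c)%:E)%E.
  by rewrite (le_lt_trans hle)// EFinN lteN2.
move=> /ereal_inf_lt[_ [A nA <-]] hA.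
near=> N.
have AN : A N by near: N.
have N0 : (0 < N)%N by near: N; exact: nbhs_infty_gt.
have : ((N%:R^-1)%:E * lne (nu N B) < (- c)%:E)%E.
  apply: le_lt_trans hA; apply: ereal_sup_ubound; by exists N.
have : nu N B \is a fin_num by exact: fin_num_measure.
case: (nu N B) => // r _ /=.
case: ifPn => [r0 _|]; first by rewrite (le_trans r0)// expR_ge0.
rewrite -ltNge => r0.
rewrite -EFinM lte_fin mulrC ltr_pdivrMr ?ltr0n// => h.
by rewrite -ler_ln ?posrE ?expR_gt0// expRK -mulNr ltW.
Unshelve. all: by end_near. Qed.

Lemma ldp_lower (nu : nat -> probability R R) I B (x c : R) :
  ldp nu I -> open B -> B x -> (I x < c%:E)%E ->
  \forall N \near \oo, expR (- (c * N%:R)) <= fine (nu N B).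
Proof.
move=> [_ hI] oB Bx hc.
have mB : measurable B by exact: open_measurable.
have [+ _ _] := hI B mB.
have -> : B° = B by apply/interior_id.
move=> hle.
have : (limn_esup (\- (fun N : nat => (N%:R^-1)%:E * lne (nu N B))) < c%:E)%E.
  rewrite -lteN2; apply: lt_le_trans hle; rewrite lteN2.
  by apply: le_lt_trans hc; apply: ereal_inf_lbound; exists x.
move=> /ereal_inf_lt[_ [A nA <-]] hA.
near=> N.
have AN : A N by near: N.
have N0 : (0 < N)%N by near: N; exact: nbhs_infty_gt.
have : (- ((N%:R^-1)%:E * lne (nu N B)) < c%:E)%E.
  apply: le_lt_trans hA; apply: ereal_sup_ubound; by exists N.
have : nu N B \is a fin_num by exact: fin_num_measure.
case: (nu N B) => // r _ /=.
have Ni : 0 < (N%:R^-1 : R) by rewrite invr_gt0 ltr0n.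
case: ifPn => [r0|]; first by rewrite gt0_muleNy ?lte_fin//= ltNge leey.
rewrite -ltNge => r0.
rewrite -EFinM -EFinN lte_fin mulrC -mulNr ltr_pdivrMr ?ltr0n// => h.
rewrite -ler_ln ?posrE ?expR_gt0// expRK; lra.
Unshelve. all: by end_near. Qed.

(** Minimizing points accumulate inside a compact sublevel set, and each
    sublevel set met with B is closed. *)
Lemma good_inf_attained I B : good I -> (forall x, (0 <= I x)%E) -> closed B ->
  (ereal_inf [set I x | x in B] < +oo)%E ->
  exists2 x, B x & I x = ereal_inf [set I x | x in B].
Proof.
move=> gI I0 cB Jy; set J := ereal_inf _ in Jy *.
have J0 : (0 <= J)%E by apply: le_ereal_inf_tmp => _ [x _ <-].
have /fineK EJ : J \is a fin_num by rewrite ge0_fin_numE.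
pose S (m : nat) := [set x | (I x <= (fine J + m.+1%:R^-1)%:E)%E].
have hx (m : nat) : exists x, B x /\ S m x.
  have : (J < (fine J + m.+1%:R^-1)%:E)%E.
    by rewrite -[ltLHS]EJ lte_fin ltrDl invr_gt0 ltr0n.
  by move=> /ereal_inf_lt[_ [x Bx <-]] /ltW; exists x.
have [u hu] := choice hx.
have uS (m j : nat) : (m <= j)%N -> S m (u j).
  move=> mj; have [_] := hu j; rewrite /S/= => /le_trans; apply.
  by rewrite lee_fin lerD2l lef_pV2 ?posrE ?ltr0n// ler_nat.
have F0 : ProperFilter (u @ \oo) by apply: fmap_proper_filter.
have /(_ (u @ \oo) F0) [] := gI (fine J + 0.+1%:R^-1).
  by exists 0%N => // j _; exact: uS.
move=> x [_ clx].
have xc (A : set R) : closed A -> (\forall j \near \oo, A (u j)) -> A x.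
  move=> cA uA; rewrite (closure_id A).1// => V Vx; exact: clx.
exists x; first by apply: xc => //; apply: nearW => j; have [] := hu j.
apply/eqP; rewrite eq_le; apply/andP; split; last first.
  apply: ereal_inf_lbound; exists x => //.
  by apply: xc => //; apply: nearW => j; have [] := hu j.
rewrite -EJ; apply/lee_addgt0Pr => e e0.
have [m _ me] := (near_infty_natSinv_lt (PosNum e0)).
have : S m x.
  apply: xc; first by apply: compact_closed; [exact: Rhausdorff|exact: gI].
  by exists m => // j; exact: uS.
move=> /le_trans; apply; rewrite -EFinD lee_fin lerD2l ltW//; by apply: (me m) => /=.
Qed.

(** The whole line has probability 1, whose logarithm is 0. *)
Lemma ldp_inf_rate0 (nu : nat -> probability R R) I :
  ldp nu I -> ereal_inf (range I) = 0%E.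
Proof.
move=> [_ hI]; have [+ _] := hI setT measurableT.
have -> : (fun N : nat => (N%:R^-1)%:E * lne (nu N setT))%E = cst 0%E.
  by apply/funext => N; rewrite probability_setT lne1 mule0.
have := @cvg_limn_einf_sup R (cst 0%E) 0%E (@cvg_cst _ _ _ _ _).
move=> [-> ->].
rewrite interiorT closureT => h1 h2.
by apply: oppe_inj; rewrite oppe0; apply/eqP; rewrite eq_le h1 h2.
Qed.

Lemma good_rate_zero (nu : nat -> probability R R) I :
  ldp nu I -> good I -> exists x, I x = 0%E.
Proof.
move=> hI gI; have [[I0 _] _] := hI.
have [] := good_inf_attained gI I0 closedT; rewrite (ldp_inf_rate0 hI)//.
by move=> x _ ?; exists x.
Qed.

Lemma good_bounded I (c : R) : good I -> exists2 M : R, 0 < M &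
  forall x, (I x <= c%:E)%E -> `|x| < M.
Proof.
move=> gI; have := compact_bounded (gI c).
move=> [M [Mr hM]]; exists (Num.max (M + 2) 1); first by rewrite lt_max ltr01 orbT.
move=> x Ix; rewrite lt_max; apply/orP; left.
apply: (@le_lt_trans _ _ (M + 1)); first by apply: hM => //; lra.
lra.
Qed.

End LDP.

(** * Borel-Cantelli and Poisson tails *)

Section BC.
Context d (T : measurableType d) (R : realType) (P : probability T R).

Lemma nneseries_le_partial (u : (\bar R)^nat) (C : \bar R) :
  (forall k, 0 <= u k)%E ->
  (forall K, \sum_(0 <= k < K) u k <= C)%E -> (\sum_(k <oo) u k <= C)%E.
Proof.
move=> u0 uC; apply: lime_le; first by apply: is_cvg_nneseries => k _ _.
exact: nearW.
Qed.

(** The form of the first Borel-Cantelli lemma for probabilities that decay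
    exponentially. *)
Lemma borel_cantelli_exp (E : nat -> set T) (C c : R) :
  (forall N, measurable (E N)) -> 0 < c ->
  (\forall N \near \oo, (P (E N) <= (C * expR (- (c * N%:R)))%:E)%E) ->
  {ae P, forall w, \forall N \near \oo, ~ E N w}.
Proof.
move=> mE c0 [N0 _ hN].
pose F k := E (N0 + k)%N.
have C0 : 0 <= C.
  have := hN N0 (leqnn _); move=> /(le_trans (measure_ge0 P (E N0))).
  by rewrite lee_fin pmulr_lge0 ?expR_gt0.
exists (lim_sup_set F); split.
- by apply: bigcapT_measurable => m; apply: bigcup_measurable => j _; exact: mE.
- apply: lim_sup_set_cvg0; first by move=> j; exact: mE.
  pose q := expR (- c).
  have q1 : q < 1 by rewrite expR_lt1 oppr_lt0.
  apply: (@le_lt_trans _ _ (C / (1 - q))%:E); last exact: ltry.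
  apply: nneseries_le_partial => [k|K]; first exact: measure_ge0.
  have := @geometric_le_lim R K C q C0 (expR_gt0 _).
  rewrite ger0_norm ?expR_ge0// => /(_ q1).
  rewrite -lee_fin; apply: le_trans; rewrite /series/= -sumEFin.
  apply: lee_sum => k _; apply: le_trans (hN _ (leq_addr _ _)) _.
  rewrite lee_fin ler_wpM2l// /q -expRM_natr ler_expR natrD.
  have := ler0n R N0; nra.
- move=> w /= hw m _; apply: contrapT => hm; apply: hw.
  exists (N0 + m)%N => // j /= mj Ej; apply: hm; exists (j - N0)%N => /=.
    by rewrite leq_subRL ?(leq_trans _ mj)// leq_addr.
  by rewrite /F subnKC// (leq_trans _ mj)// leq_addr.
Qed.

Lemma nat_rv_le (X : {RV P >-> nat}) (D : set nat) (f : nat -> R) (C : R) :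
  (forall j, 0 <= f j) -> (forall j, D j -> P [set w | X w = j] <= (f j)%:E)%E ->
  (forall K, \sum_(0 <= k < K) f k <= C) -> (P (X @^-1` D) <= C%:E)%E.
Proof.
move=> f0 fD fC.
pose F j := if j \in D then [set w | X w = j] else set0.
have mX j : measurable [set w | X w = j].
  exact: (@measurable_funPTI _ _ _ _ X [set j]).
have mF j : measurable (F j) by rewrite /F; case: ifP.
apply: (@le_trans _ _ (\sum_(j <oo) P (F j))%E).
  apply: measure_sigma_subadditive => //.
    exact: (@measurable_funPTI _ _ _ _ X D).
  move=> w Dw; exists (X w) => //.
  by rewrite /F; case: ifPn => //; rewrite notin_setE.
apply: nneseries_le_partial => [k|K]; first exact: measure_ge0.
rewrite (@le_trans _ _ (\sum_(0 <= k < K) f k)%:E) ?lee_fin//.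
rewrite -sumEFin; apply: lee_sum => k _; rewrite /F.
case: ifPn => [|_]; first by rewrite inE => /fD.
by rewrite measure0 lee_fin.
Qed.

Lemma expR_partial (x : R) K : 0 <= x -> \sum_(0 <= k < K) x ^+ k / k`!%:R <= expR x.
Proof.
move=> x0; rewrite expRE.
have := @nondecreasing_cvgn_le R (series (exp_coeff x)) _ (is_cvg_series_exp_coeff x) K.
have -> : pseries (fun n : nat => n`!%:R^-1) x = series (exp_coeff x).
  by apply/funext => N; rewrite /pseries /= /series /=; apply: eq_bigr => i _;
    rewrite /exp_coeff /= mulrC.
apply.
apply: nondecreasing_series => k _ _; rewrite exp_coeffE/=.
by rewrite mulr_ge0// exprn_ge0.
Qed.

(** The Chernoff bound with parameter t, for t > 1 on lower tails and for t < 1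
    on upper tails: multiply the probability of j by t^(m - j), which is at
    least 1 on D, and sum over all j. *)
Lemma poisson_chernoff (X : {RV P >-> nat}) (lam t : R) (D : set nat) (m : nat) :
  poisson_rv X lam -> 0 < lam -> 0 < t ->
  (forall j, D j -> t ^+ j <= t ^+ m) ->
  (P (X @^-1` D) <= (t ^+ m * expR (lam / t - lam))%:E)%E.
Proof.
move=> hX l0 t0 hD.
pose f j := t ^+ m * expR (- lam) * ((lam / t) ^+ j / j`!%:R).
apply: (@nat_rv_le X D f) => [j|j Dj|K].
- by rewrite /f !mulr_ge0 ?expR_ge0 ?exprn_ge0 ?divr_ge0 ?invr_ge0// ltW.
- rewrite hX lee_fin /poisson_pmf l0 /f.
  have -> : t ^+ m * expR (- lam) * ((lam / t) ^+ j / j`!%:R) =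
    (lam ^+ j * j`!%:R^-1 * expR (- lam)) * (t ^+ m / t ^+ j).
    by rewrite expr_div_n; ring.
  rewrite ler_peMr ?mulr_ge0 ?expR_ge0 ?exprn_ge0 ?invr_ge0 ?(ltW l0)//.
  by rewrite ler_pdivlMr ?exprn_gt0// mul1r; exact: hD.
- rewrite /f -mulr_sumr expRD [expR _ * _]mulrC mulrA.
  apply: ler_wpM2l; first by rewrite mulr_ge0 ?expR_ge0 ?exprn_ge0// ltW.
  by apply: expR_partial; rewrite divr_ge0 ?ltW.
Qed.

(** Chernoff bound with t = 2: the factor 2^(lambda/4) is at most
    exp (lambda/4), against exp (- lambda/2). *)
Lemma poisson_lower (X : {RV P >-> nat}) k :
  poisson_rv X (2 ^+ k) ->
  (P (X @^-1` [set j | (4 * j <= 2 ^ k)%N]) <= (expR (- (2 ^+ k / 4)))%:E)%E.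
Proof.
move=> hX.
have l0 : 0 < 2 ^+ k :> R by rewrite exprn_gt0.
apply: (le_trans (@poisson_chernoff X _ 2 _ (2 ^ k %/ 4) hX l0 _ _)) => //.
  move=> j /= hj; rewrite ler_eXn2l ?ltr1n// leq_divRL// mulnC//.
set m := (_ %/ _)%N; rewrite lee_fin.
have m4 : m%:R <= 2 ^+ k / 4 :> R.
  rewrite ler_pdivlMr// -natrM -natrX ler_nat; exact: leq_trunc_div.
have e2 : 2 <= expR 1 :> R by apply: le_trans (expR_ge1Dx 1).
have : (2:R) ^+ m <= expR m%:R by rewrite -[m%:R]mul1r expRM_natr lerXn2r ?nnegrE ?expR_ge0.
move=> /ler_wpM2r => /(_ (expR (2 ^+ k / 2 - 2 ^+ k)) (expR_ge0 _)) /le_trans; apply.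
rewrite -expRD ler_expR; lra.
Qed.

(** Chernoff bound with t = 1/2: the factor 2^(- 4 lambda) is at most
    exp (- 2 lambda), against exp lambda. *)
Lemma poisson_upper (X : {RV P >-> nat}) k :
  poisson_rv X (2 ^+ k) ->
  (P (X @^-1` [set j | (4 * 2 ^ k <= j)%N]) <= (expR (- (2 ^+ k / 4)))%:E)%E.
Proof.
move=> hX.
have l0 : 0 < 2 ^+ k :> R by rewrite exprn_gt0.
apply: (le_trans (@poisson_chernoff X _ 2^-1 _ (4 * 2 ^ k) hX l0 _ _)) => //.
  move=> j /= hj; apply: ler_wiXn2l => //; lra.
rewrite lee_fin.
have e2 : 2^-1 <= expR (- 2^-1) :> R by apply: le_trans (expR_ge1Dx _); lra.
have : (2^-1:R) ^+ (4 * 2 ^ k) <= expR (- 2 ^-1 * (4 * 2 ^ k)%:R).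
  by rewrite expRM_natr lerXn2r ?nnegrE ?expR_ge0// invr_ge0.
move=> /ler_wpM2r => /(_ (expR (2 ^+ k / 2^-1 - 2 ^+ k)) (expR_ge0 _)) /le_trans; apply.
rewrite -expRD ler_expR natrM natrX invrK; lra.
Qed.

End BC.

(** * Moments of the number of events that occur *)

Definition num_occ (R : realType) (T : Type) (J : finType) (E : J -> set T) (w : T)
    : R :=
  \sum_j \1_(E j) w.

Section Moments.
Context d (T : measurableType d) (R : realType) (P : probability T R).

Lemma markov_real (f : T -> R) (t m : R) : measurable_fun setT f ->
  (forall w, 0 <= f w) -> 0 < t -> (\int[P]_w (f w)%:E = m%:E)%E ->
  (P [set w | (t <= f w)%R] <= (m / t)%:E)%E.
Proof.
move=> mf f0 t0 fm; set F := [set w | _].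
have mF : measurable F.
  have -> : F = f @^-1` `[t, +oo[ by apply/seteqP; split=> w; rewrite /F /= in_itv/= andbT.
  by rewrite -[X in measurable X]setTI; apply: mf.
have : (t%:E * P F <= m%:E)%E.
  rewrite -fm -(integral_cst P mF) integral_mkcond; apply: ge0_le_integral => //.
  - by move=> w _; apply: erestrict_ge0 => x _; rewrite lee_fin ltW.
  - by apply/(measurable_restrictT _ mF).1; exact: measurable_cst.
  - by apply/measurable_EFinP.
  - move=> w _; rewrite patchE; case: ifPn => [|_]; last by rewrite lee_fin.
    by rewrite inE lee_fin.
by rewrite EFinM lee_pdivlMr// muleC.
Qed.

Context (J : finType) (E : J -> set T).
Hypothesis mE : forall j, measurable (E j).


Lemma num_occ_ge0 w : 0 <= num_occ R E w.
Proof. by apply: sumr_ge0 => j _; rewrite indicE. Qed.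

Lemma measurable_num_occ : measurable_fun setT (num_occ R E).
Proof. by apply: measurable_sum => j; exact: measurable_indic. Qed.

Lemma integral_num_occ :
  (\int[P]_w (num_occ R E w)%:E = (\sum_j fine (P (E j)))%:E)%E.
Proof.
rewrite /num_occ; under eq_integral do rewrite -sumEFin.
rewrite ge0_integral_sum//.
- rewrite -sumEFin; apply: eq_bigr => j _.
  by rewrite integral_indic// setIT fineK// fin_num_measure.
- by move=> j; apply/measurable_EFinP; exact: measurable_indic.
Qed.

End Moments.

Section SecondMoment.
Context d (T : measurableType d) (R : realType) (P : probability T R).
Context (J : finType) (E : J -> set T).
Hypothesis mE : forall j, measurable (E j).

Lemma num_occ_sq w : num_occ R E w ^+ 2 = num_occ R (fun u : J * J => E u.1 `&` E u.2) w.
Proof.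
rewrite expr2 {1 2}/num_occ mulr_suml /num_occ -(pair_bigA _ (fun i j => \1_(E i `&` E j) w)) /=.
apply: eq_bigr => i _; rewrite mulr_sumr; apply: eq_bigr => j _.
by rewrite indicI.
Qed.

Lemma num_occ_markov (t : R) : 0 < t ->
  (P [set w | (t <= num_occ R E w)%R] <= ((\sum_j fine (P (E j))) / t)%:E)%E.
Proof.
move=> t0; apply: markov_real => //.
- exact: measurable_num_occ.
- by move=> w; exact: num_occ_ge0.
- exact: integral_num_occ.
Qed.

(** The variance is the sum of the probabilities of all the pairwise
    intersections minus the squared mean. *)
Lemma num_occ_chebyshev (m S2 : R) : 0 < m -> \sum_j fine (P (E j)) = m ->
  \sum_i \sum_j fine (P (E i `&` E j)) <= S2 ->
  (P [set w | (num_occ R E w < m / 2)%R] <= (4 * (S2 - m ^+ 2) / m ^+ 2)%:E)%E.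
Proof.
move=> m0 hm hS.
pose g w := (num_occ R E w - m) ^+ 2.
have mn : measurable_fun setT (num_occ R E) by exact: measurable_num_occ.
have mg : measurable_fun setT g by apply: measurable_funX; apply: measurable_funB.
have g0 w : 0 <= g w by rewrite sqr_ge0.
set S := \sum_i \sum_j _ in hS.
have I2 : (\int[P]_w (num_occ R E w ^+ 2)%:E = S%:E)%E.
  under eq_integral do rewrite num_occ_sq.
  rewrite integral_num_occ; last by move=> j; exact: measurableI.
  by rewrite /S pair_bigA.
have Ig : (\int[P]_w (g w)%:E = (S - m ^+ 2)%:E)%E.
  have h : (\int[P]_w (g w)%:E + (2 * m)%:E * m%:E = S%:E + (m ^+ 2)%:E)%E.
    rewrite -I2 -{2}hm -(integral_num_occ P mE) -ge0_integralZl//; first last.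
    - by rewrite lee_fin; lra.
    - by move=> w _; rewrite lee_fin num_occ_ge0.
    - exact/measurable_EFinP.
    rewrite -ge0_integralD//; first last.
    - apply/measurable_EFinP; apply: measurable_funM => //.
    - by move=> w _; rewrite -EFinM lee_fin mulr_ge0 ?num_occ_ge0//; lra.
    - exact/measurable_EFinP.
    - by move=> w _; rewrite lee_fin.
    have <- : (\int[P]_w (m ^+ 2)%:E = (m ^+ 2)%:E)%E.
      apply: etrans (integral_cst P measurableT (m ^+ 2)%:E) _.
      exact: etrans (f_equal (fun z => (m ^+ 2)%:E * z)%E (probability_setT P)) (mule1 _).
    rewrite -ge0_integralD//; first last.
    - by move=> w _; rewrite lee_fin sqr_ge0.
    - by apply/measurable_EFinP; apply: measurable_funX.
    - by move=> w _; rewrite lee_fin sqr_ge0.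
    apply: eq_integral => w _; rewrite -EFinM -!EFinD; congr EFin.
    by rewrite /g; ring.
  have := h; case: (\int[P]_w _)%E => [r| |]//.
  by rewrite -EFinM -!EFinD => -[h']; congr EFin; lra.
have m2 : 0 < m ^+ 2 / 4 by rewrite divr_gt0 ?exprn_gt0.
apply: (@le_trans _ _ (P [set w | m ^+ 2 / 4 <= g w])).
  apply: le_measure; rewrite ?inE.
  - have -> : [set w | num_occ R E w < m / 2] = num_occ R E @^-1` `]-oo, (m / 2)[.
      by apply/seteqP; split=> w; rewrite /= in_itv/=.
    by rewrite -[X in measurable X]setTI; apply: mn.
  - have -> : [set w | m ^+ 2 / 4 <= g w] = g @^-1` `[m ^+ 2 / 4, +oo[.
      by apply/seteqP; split=> w; rewrite /= in_itv/= andbT.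
    by rewrite -[X in measurable X]setTI; apply: mg.
  - move=> w /=; rewrite /g => h; have := num_occ_ge0 R E w; nra.
apply: (le_trans (markov_real mg g0 m2 Ig)).
rewrite lee_fin invf_div mulrA [4 * _]mulrC ler_wpM2r ?invr_ge0 ?exprn_ge0 ?(ltW m0)//.
by rewrite ler_wpM2r// lerD2r.
Qed.

End SecondMoment.

(** * Branches, nodes and common prefixes *)

Section TreeComb.
Context (n : nat) (l : 'I_n -> nat).
Local Notation branch := {dffun forall i : 'I_n, 'I_(l i).+1}.
Implicit Types (s t : branch).

Definition agree (k : nat) s t :=
  [forall i : 'I_n, (i < k)%N ==> (s i == t i)].

Lemma agreeP k s t :
  reflect (forall i : 'I_n, (i < k)%N -> s i = t i) (agree k s t).
Proof.
apply: (iffP forallP) => [h i ik|h i]; first by have /implyP/(_ ik)/eqP := h i.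
by apply/implyP => ik; rewrite h.
Qed.

Lemma card_agree k s :
  #|[pred t | agree k s t]| = (\prod_(i < n | (k <= i)%N) (l i).+1)%N.
Proof.
pose F (i : 'I_n) : pred 'I_(l i).+1 := fun x => (i < k)%N ==> (s i == x).
have -> : #|[pred t | agree k s t]| = #|(family F : simpl_pred branch)|.
  apply: eq_card => t; rewrite [LHS]inE; apply/idP/familyP => [h i|h].
    exact: (forallP h).
  by apply/forallP => i; exact: h.
rewrite card_family foldrE big_map big_enum/= [RHS]big_mkcond/=.
apply: eq_bigr => i _; rewrite leqNgt /F; case: (i < k)%N => /=.
  by rewrite (@eq_card _ _ (pred1 (s i))) ?card1// => x; rewrite !inE eq_sym.
by rewrite (@eq_card _ _ predT) ?card_ord.
Qed.

Lemma card_branch : #|{: branch}| = (\prod_(i < n) (l i).+1)%N.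
Proof.
have [s _|e] := pickP (predT : pred branch).
  rewrite -[RHS](card_agree 0 s); apply: eq_card => t; rewrite !inE.
  by apply/esym/agreeP.
by have := e [ffun=> ord0].
Qed.

Lemma size_node s (i : 'I_n) : size (node s i) = i.+1.
Proof.
rewrite /node size_map size_filter -(count_map val (fun j => (j <= i)%N)) val_enum_ord.
have := ltn_ord i; move: (nat_of_ord i) => {}i ni.
have -> : n = (i.+1 + (n - i.+1))%N by rewrite subnKC.
rewrite iotaD count_cat add0n [X in (_ + X)%N](_ : _ = 0%N).
  rewrite addn0 -[RHS](size_iota 0) -count_predT; apply: eq_in_count => j.
  by rewrite mem_iota /= add0n ltnS => ->.
apply/eqP; rewrite -leqn0 leqNgt -has_count.
by apply/hasPn => j; rewrite mem_iota -ltnNge => /andP[].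
Qed.

(** A node is the word of the choices made down to it, so it determines the whole
    path from the root. *)
Lemma node_eq s t (i : 'I_n) : node s i = node t i <-> agree i.+1 s t.
Proof.
split => [/eq_in_map h|/agreeP h].
  apply/agreeP => j ji; apply/val_inj/h; rewrite mem_filter mem_enum andbT//.
by apply/eq_in_map => j; rewrite mem_filter => /andP[ji _]; rewrite h.
Qed.

Lemma node_inj s t (i j : 'I_n) : node s i = node t j -> i = j.
Proof. by move=> /(congr1 size); rewrite !size_node => -[/val_inj]. Qed.

(** The witness k is the length of the longest common prefix. *)
Lemma agree_max s t : exists2 k, (k <= n)%N &
  agree k s t /\ forall i : 'I_n, (k <= i)%N -> ~~ agree i.+1 s t.
Proof.
have e0 : exists k, (k <= n)%N && agree k s t by exists 0%N; apply/andP; split => //; apply/forallP.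
have eb k : (k <= n)%N && agree k s t -> (k <= n)%N by move=> /andP[].
have [k /andP[kn ak] hk] := ex_maxnP e0 eb.
exists k => //; split => // i ki; apply/negP => ai.
by have := hk i.+1; rewrite ai ltn_ord ltnNge ki => /(_ isT).
Qed.

Definition nodes (D : pred nat) s : seq (seq nat) :=
  [seq node s i | i : 'I_n <- enum 'I_n & D i].

Lemma nodes_uniq D s : uniq (nodes D s).
Proof.
rewrite map_inj_uniq; first exact/filter_uniq/enum_uniq.
by move=> i j; exact: node_inj.
Qed.

Lemma big_nodes (R : realType) D s (q : nat -> R) :
  \prod_(v <- nodes D s) q (size v).-1 = \prod_(i < n | D i) q i.
Proof.
rewrite big_map big_filter big_enum_cond/=; apply: eq_bigr => i _.
by rewrite size_node.
Qed.

Lemma nodes_size D s v : v \in nodes D s -> (0 < size v <= n)%N.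
Proof. by move=> /mapP[i _ ->]; rewrite size_node ltn_ord. Qed.

End TreeComb.

(** * First and second moment of the number of good branches *)

Section TreeProb.
Context d (T : measurableType d) (R : realType) (P : probability T R).
Context (n : nat) (l : 'I_n -> nat).
Local Notation branch := {dffun forall i : 'I_n, 'I_(l i).+1}.
Implicit Types (s t : branch).

(** The event A v is to hold at the node v; the events attached to distinct
    nodes are independent, and q j is their common probability at level j. *)
Context (A : seq nat -> set T) (q : nat -> R).
Hypothesis mA : forall v, measurable (A v).
Hypothesis q_ge0 : forall j, 0 <= q j.
Hypothesis hA : forall r : seq (seq nat), uniq r ->
  (forall v, v \in r -> (0 < size v <= n)%N) ->
  P (\bigcap_(v in [set` r]) A v) = (\prod_(v <- r) q (size v).-1)%:E.

Definition prefix_ev (k : nat) s : set T :=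
  \bigcap_(v in [set` nodes (fun i => (i < k)%N) s]) A v.

Lemma prefix_evP k s w : prefix_ev k s w <-> forall i : 'I_n, (i < k)%N -> A (node s i) w.
Proof.
split => [h i ik|h v /= /mapP[i]].
  by apply: h => /=; apply: map_f; rewrite mem_filter ik mem_enum.
by rewrite mem_filter => /andP[ik _] ->; exact: h.
Qed.

Lemma measurable_prefix_ev k s : measurable (prefix_ev k s).
Proof. by apply: fin_bigcap_measurable => // v _. Qed.

Lemma prob_prefix_ev k s : fine (P (prefix_ev k s)) = \prod_(i < n | (i < k)%N) q i.
Proof.
rewrite /prefix_ev hA ?nodes_uniq//=; last by move=> v; exact: nodes_size.
by rewrite big_nodes.
Qed.

(** The two branches share exactly their first k nodes: these are counted once,
    and all the other nodes are distinct. *)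
Lemma prob_prefix_evI k s t : agree k s t -> (forall i : 'I_n, (k <= i)%N -> ~~ agree i.+1 s t) ->
  fine (P (prefix_ev n s `&` prefix_ev n t)) = \prod_(i < n) q i * \prod_(i < n | (k <= i)%N) q i.
Proof.
move=> ak nak.
pose r := nodes xpredT s ++ nodes (fun i => k <= i)%N t.
have -> : prefix_ev n s `&` prefix_ev n t = \bigcap_(v in [set` r]) A v.
  apply/seteqP; split => [w [/prefix_evP hs /prefix_evP ht] v /=|w h].
    rewrite mem_cat => /orP[] /mapP[i _ ->]; [exact: hs|exact: ht].
  split; apply/prefix_evP => i _.
    by apply: h; rewrite /= mem_cat; apply/orP; left; apply: map_f; rewrite mem_filter mem_enum.
  apply: h; rewrite /= mem_cat; apply/orP; have [ki|ik] := leqP k i.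
    by right; apply: map_f; rewrite mem_filter mem_enum ki.
  left; have -> : node t i = node s i.
    apply/esym/node_eq/agreeP => j ji; move/agreeP : ak; apply; exact: leq_trans ji ik.
  by apply: map_f; rewrite mem_filter mem_enum.
rewrite hA.
- by rewrite big_cat /= !big_nodes.
- rewrite cat_uniq !nodes_uniq andbT /=; apply/hasPn => v /mapP[i].
  rewrite mem_filter => /andP[ki _] ->; apply/negP => /mapP[j _ e].
  have ij := node_inj e; subst j; move/node_eq: e => ag.
  have := nak i ki; suff -> : agree i.+1 s t by [].
  by apply/agreeP => j ji; apply/esym; move/agreeP : ag; apply.
- by move=> v; rewrite mem_cat => /orP[] /nodes_size.
Qed.

Local Notation M i := ((l i).+1%:R : R).

Definition mean_count k := \prod_(i < n) M i * \prod_(i < n | (i < k)%N) q i.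

Lemma mean_countE : mean_count n = \prod_(i < n) (M i * q i).
Proof.
rewrite big_split /= /mean_count; congr (_ * _); apply: eq_bigl => i.
by rewrite ltn_ord.
Qed.

Lemma sum_prob_prefix_ev k : \sum_s fine (P (prefix_ev k s)) = mean_count k.
Proof.
under eq_bigr do rewrite prob_prefix_ev.
by rewrite sumr_const card_branch -mulr_natl natr_prod.
Qed.

Lemma count_markov k (u : R) : 0 < u ->
  (P [set w | (u <= num_occ R (prefix_ev k) w)%R] <= (mean_count k / u)%:E)%E.
Proof.
move=> u0; rewrite -sum_prob_prefix_ev; apply: num_occ_markov => // s; exact: measurable_prefix_ev.
Qed.

(** A good prefix of length k extends to as many branches as there are choices
    at the levels from k on.  The Markov inequality with this threshold divides
    the number of these choices out of the expectation. *)
Lemma exists_prefix_bound k :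
  (P [set w | exists s, prefix_ev k s w] <= (\prod_(i < n | (i < k)%N) (M i * q i))%:E)%E.
Proof.
pose W : R := \prod_(i < n | (k <= i)%N) M i.
have W0 : 0 < W by apply: prodr_gt0.
have mn : measurable_fun setT (num_occ R (prefix_ev k)).
  by apply: measurable_num_occ => s; exact: measurable_prefix_ev.
apply: (@le_trans _ _ (P [set w | (W <= num_occ R (prefix_ev k) w)%R])).
  apply: le_measure; rewrite ?inE.
  - rewrite (_ : [set w | exists s, prefix_ev k s w] = \bigcup_s prefix_ev k s).
      apply: fin_bigcup_measurable; first exact: finite_finset.
      by move=> s _; exact: measurable_prefix_ev.
    by apply/seteqP; split => w [s] // ; exists s.
  - have -> : [set w | W <= num_occ R (prefix_ev k) w] =
        num_occ R (prefix_ev k) @^-1` `[W, +oo[.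
      by apply/seteqP; split=> w; rewrite /= in_itv/= andbT.
    by rewrite -[X in measurable X]setTI; apply: mn.
  - move=> w [s sw] /=.
    rewrite /W -natr_prod -(card_agree k s) /num_occ.
    rewrite (bigID (fun t => agree k s t)) /=.
    apply: (@le_trans _ _ (\sum_(t | agree k s t) \1_(prefix_ev k t) w)); last first.
      by rewrite lerDl; apply: sumr_ge0 => t _; rewrite indicE.
    rewrite (eq_bigr (fun=> 1)); last first.
      move=> t /agreeP st; rewrite indicE mem_set//; apply/prefix_evP => i ik.
      have -> : node t i = node s i.
        by apply/esym/node_eq/agreeP => j ji; apply: st; exact: leq_trans ji ik.
      by move/prefix_evP : sw; apply.
    by rewrite sumr_const; rewrite (@eq_card _ _ [pred t | agree k s t]).
apply: le_trans (count_markov k W0) _; rewrite lee_fin ler_pdivrMr// /mean_count.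
rewrite (bigID (fun i : 'I_n => (i < k)%N)) /= big_split /= -/W.
rewrite [X in _ * X * _ <= _](_ : _ = W) 1?mulrAC//.
by apply: eq_bigl => i; rewrite -leqNgt.
Qed.

(** Bound the pairs whose longest common prefix has length k by those that agree
    on k levels at least.  The term k = 0 is then exactly the squared mean, and
    the k-th term is the squared mean divided by the expected number of good
    prefixes of length k. *)
Lemma sum_prob_prefix_evI : (forall i, 0 < q i) ->
  \sum_s \sum_t fine (P (prefix_ev n s `&` prefix_ev n t)) <=
  mean_count n ^+ 2 + mean_count n ^+ 2 *
    \sum_(1 <= k < n.+1) (\prod_(i < n | (i < k)%N) (M i * q i))^-1.
Proof.
move=> q0.
rewrite mean_countE.
set m := \prod_(i < n) _.
have m0 : 0 < m by apply: prodr_gt0 => i _; rewrite mulr_gt0.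
pose b k := \prod_(i < n | (i < k)%N) (M i * q i).
have b0 k : 0 < b k by apply: prodr_gt0 => i _; rewrite mulr_gt0.
pose c k := \prod_(i < n | (k <= i)%N) (M i * q i).
have bc k : b k * c k = m.
  rewrite /m (bigID (fun i : 'I_n => (i < k)%N)) /=; congr (_ * _).
  by apply: eq_bigl => i; rewrite leqNgt.
pose Q := \prod_(i < n) q i.
pose Qk k := \prod_(i < n | (k <= i)%N) q i.
have Q0 : 0 <= Q by apply: prodr_ge0.
have Qk0 k : 0 <= Qk k by apply: prodr_ge0.
have H s t : fine (P (prefix_ev n s `&` prefix_ev n t)) <=
    \sum_(0 <= k < n.+1) (agree k s t)%:R * (Q * Qk k).
  have [k kn [ak nak]] := agree_max s t.
  rewrite (prob_prefix_evI ak nak) (bigD1_seq k) ?mem_index_iota ?iota_uniq//=.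
  rewrite ak mul1r lerDl; apply: sumr_ge0 => j _; rewrite !mulr_ge0//.
have H2 s : \sum_t fine (P (prefix_ev n s `&` prefix_ev n t)) <= Q * \sum_(0 <= k < n.+1) c k.
  apply: le_trans (ler_sum _ (fun t _ => H s t)) _.
  rewrite exchange_big /= mulr_sumr; apply: ler_sum => k _.
  rewrite -mulr_suml -natr_sum /c big_split /= -natr_prod -(card_agree k s) -/(Qk k).
  rewrite (_ : (\sum_t agree k s t)%N = #|[pred t | agree k s t]|); first by rewrite mulrCA.
  by rewrite -sum1_card [RHS]big_mkcond.
apply: le_trans (ler_sum _ (fun s _ => H2 s)) _.
rewrite sumr_const card_branch -mulr_natl mulrA natr_prod -big_split /= -/m.
rewrite big_nat_recl//= -[X in _ * (X + _)]/(c 0%N).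
have -> : c 0%N = m by rewrite /c /m; apply: eq_bigl => i.
rewrite mulrDr -expr2 lerD2l expr2 -mulrA ler_wpM2l ?(ltW m0)// mulr_sumr big_add1 /=.
by apply: ler_sum => k _; rewrite -/(b k.+1) -(bc k.+1) [b _ * _]mulrC mulfK ?gt_eqF.
Qed.

Lemma count_lower_bound : (forall i, 0 < q i) ->
  (P [set w | (num_occ R (prefix_ev n) w < mean_count n / 2)%R] <=
   (4 * \sum_(1 <= k < n.+1) (\prod_(i < n | (i < k)%N) (M i * q i))^-1)%:E)%E.
Proof.
move=> q0.
have m0 : 0 < mean_count n by rewrite mulr_gt0// prodr_gt0.
have := num_occ_chebyshev (measurable_prefix_ev n) m0 (sum_prob_prefix_ev n)
  (sum_prob_prefix_evI q0).
move=> /le_trans; apply; rewrite lee_fin.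
rewrite [X in 4 * X](_ : _ = mean_count n ^+ 2 *
   \sum_(1 <= k < n.+1) (\prod_(i < n | (i < k)%N) (M i * q i))^-1); last by ring.
by rewrite mulrA mulrAC mulfK// gt_eqF// exprn_gt0.
Qed.

End TreeProb.

(** * Almost sure exponential bounds on the number of good branches *)

Section Asymp.
Context (R : realType).

Lemma near_expR_ge (C c : R) : 0 < c -> \forall N \near \oo, C <= expR (c * N%:R).
Proof.
move=> c0; near=> N; apply: le_trans (expR_ge1Dx _).
have h : C / c <= N%:R by near: N; exact: nbhs_infty_ger.
rewrite ler_pdivrMr// in h; lra.
Unshelve. all: by end_near. Qed.

Lemma prod_le_expR n (P : pred 'I_n) (F u : 'I_n -> R) (x : R) :
  (forall i, P i -> 0 <= F i <= expR (u i * x)) ->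
  \prod_(i < n | P i) F i <= expR ((\sum_(i < n | P i) u i) * x).
Proof.
by move=> h; rewrite mulr_suml expR_sum; apply: ler_prod.
Qed.

Lemma prod_ge_expR n (P : pred 'I_n) (F u : 'I_n -> R) (x : R) :
  (forall i, P i -> expR (u i * x) <= F i) ->
  expR ((\sum_(i < n | P i) u i) * x) <= \prod_(i < n | P i) F i.
Proof.
move=> h; rewrite mulr_suml expR_sum; apply: ler_prod => i Pi.
by rewrite expR_ge0 h.
Qed.

End Asymp.

Section AlmostSure.
Context (R : realType) (n : nat) d (T : measurableType d) (P : probability T R).
Context (l : 'I_n -> nat -> nat) (A : nat -> seq nat -> set T) (q : nat -> nat -> R).
Hypothesis mA : forall N v, measurable (A N v).
Hypothesis q_ge0 : forall N j, 0 <= q N j.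
Hypothesis hA : forall N (r : seq (seq nat)), (n <= N)%N -> uniq r ->
  (forall v, v \in r -> (0 < size v <= n)%N) ->
  P (\bigcap_(v in [set` r]) A N v) = (\prod_(v <- r) q N (size v).-1)%:E.

Local Notation lN N := (fun i => l i N).
Local Notation M i N := ((l i N).+1%:R : R).
Local Notation cnt N w := (num_occ R (@prefix_ev _ T n (lN N) (A N) n) w).

Lemma ae_no_prefix k (u : 'I_n -> R) :
  (forall i : 'I_n, (i < k)%N ->
    \forall N \near \oo, M i N * q N i <= expR (u i * N%:R)) ->
  \sum_(i < n | (i < k)%N) u i < 0 ->
  {ae P, forall w, \forall N \near \oo,
    ~ exists s, @prefix_ev _ T n (lN N) (A N) k s w}.
Proof.
move=> hu u0.
apply: (@borel_cantelli_exp _ _ _ P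
   (fun N => [set w | exists s, @prefix_ev _ T n (lN N) (A N) k s w])
   1 (- \sum_(i < n | (i < k)%N) u i)).
- move=> N; rewrite (_ : mkset _ = \bigcup_s @prefix_ev _ T n (lN N) (A N) k s).
    by apply: fin_bigcup_measurable; [exact: finite_finset|move=> s _; exact: measurable_prefix_ev].
  by apply/seteqP; split => w [s] // ; exists s.
- by rewrite oppr_gt0.
- near=> N.
  have nN : (n <= N)%N by near: N; exact: nbhs_infty_ge.
  apply: le_trans (exists_prefix_bound (lN N) (mA N) (fun r => @hA N r nN) k) _.
  rewrite lee_fin mul1r mulNr opprK; apply: prod_le_expR => i ik.
  rewrite mulr_ge0//=; move: i ik; near: N.
  apply: filter_forall => i; have [ik|_] := boolP (i < k)%N; last exact: nearW.
  by near=> N => _; near: N; exact: hu.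
Unshelve. all: by end_near. Qed.

Lemma ae_count_upper (u : 'I_n -> R) (t : R) :
  (forall i : 'I_n, \forall N \near \oo, M i N * q N i <= expR (u i * N%:R)) ->
  \sum_(i < n) u i < t ->
  {ae P, forall w, \forall N \near \oo, cnt N w <= expR (t * N%:R)}.
Proof.
move=> hu ut.
have : {ae P, forall w, \forall N \near \oo, ~ [set w | expR (t * N%:R) <= cnt N w] w}.
  apply: (@borel_cantelli_exp _ _ _ P (fun N => [set w | expR (t * N%:R) <= cnt N w])
     1 (t - \sum_(i < n) u i)).
  - move=> N; have -> : [set w | expR (t * N%:R) <= cnt N w] =
       num_occ R (@prefix_ev _ T n (lN N) (A N) n) @^-1` `[expR (t * N%:R), +oo[.
      by apply/seteqP; split=> w; rewrite /= in_itv/= andbT.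
    rewrite -[X in measurable X]setTI.
    by apply: measurable_num_occ => // s; exact: measurable_prefix_ev.
  - by rewrite subr_gt0.
  - near=> N.
    have nN : (n <= N)%N by near: N; exact: nbhs_infty_ge.
    apply: le_trans (count_markov (lN N) (mA N) (fun r => @hA N r nN) n (expR_gt0 _)) _.
    rewrite lee_fin mul1r ler_pdivrMr ?expR_gt0// -expRD.
    rewrite (_ : _ + _ = (\sum_(i < n) u i) * N%:R); last by ring.
    rewrite mean_countE; apply: prod_le_expR => i _.
    rewrite mulr_ge0//=; move: i; near: N.
    exact: filter_forall.
apply: filterS => w; apply: filterS => N /=.
by move=> /negP; rewrite -ltNge => /ltW.
Unshelve. all: by end_near. Qed.

(** A positive lower bound c of the partial sums of the u i is an exponential
    rate at which the relative variance tends to 0; the factor 1/2 lost in the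
    Chebyshev inequality is absorbed by the gap between t and the full sum. *)
Lemma ae_count_lower (u : 'I_n -> R) (t : R) :
  (forall N j, (n <= j)%N -> 0 < q N j) ->
  (forall i : 'I_n, \forall N \near \oo, expR (u i * N%:R) <= M i N * q N i) ->
  (forall k, (k < n)%N -> 0 < \sum_(i < n | (i <= k)%N) u i) ->
  t < \sum_(i < n) u i ->
  {ae P, forall w, \forall N \near \oo, expR (t * N%:R) <= cnt N w}.
Proof.
move=> q1 hu u0 ut.
pose S k := \sum_(i < n | (i < k)%N) u i.
pose c := \big[Order.min/1]_(k < n) S k.+1.
have c0 : 0 < c.
  apply: (big_ind (fun x => 0 < x)) => // [x y x0 y0|k _]; first by rewrite lt_min x0.
  by rewrite (lt_le_trans (u0 k (ltn_ord k)))// le_eqVlt; apply/orP; left.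
pose E N := [set w | cnt N w < mean_count (lN N) (q N) n / 2].
have : {ae P, forall w, \forall N \near \oo, ~ E N w}.
  apply: (@borel_cantelli_exp _ _ _ P E (4 * n%:R) c) => //.
  - move=> N; have -> : E N =
       num_occ R (@prefix_ev _ T n (lN N) (A N) n) @^-1` `]-oo, (mean_count (lN N) (q N) n / 2)[.
      by apply/seteqP; split=> w; rewrite /E /= in_itv/=.
    rewrite -[X in measurable X]setTI.
    by apply: measurable_num_occ => // s; exact: measurable_prefix_ev.
  - near=> N.
    have nN : (n <= N)%N by near: N; exact: nbhs_infty_ge.
    have huN : forall i : 'I_n, expR (u i * N%:R) <= M i N * q N i.
      by near: N; exact: filter_forall.
    have q0 j : 0 < q N j.
      have [nj|jn] := leqP n j; first exact: q1.
      have := lt_le_trans (expR_gt0 _) (huN (Ordinal jn)).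
      by rewrite pmulr_rgt0.
    apply: le_trans (count_lower_bound (lN N) (mA N) (q_ge0 N) (fun r => @hA N r nN) q0) _.
    rewrite lee_fin -mulrA ler_wpM2l// big_add1 /= big_mkord.
    have -> : n%:R * expR (- (c * N%:R)) = \sum_(k < n) expR (- (c * N%:R)).
      by rewrite sumr_const card_ord mulr_natl.
    apply: ler_sum => k _; rewrite expRN lef_pV2 ?posrE ?expR_gt0//; last first.
      by apply: prodr_gt0 => i _; rewrite mulr_gt0.
    apply: (@le_trans _ _ (expR (S k.+1 * N%:R))).
      by rewrite ler_expR ler_wpM2r//; exact: bigmin_le.
    exact: prod_ge_expR.
apply: filterS => w; move=> hw; near=> N.
have huN : forall i : 'I_n, expR (u i * N%:R) <= M i N * q N i.
  by near: N; exact: filter_forall.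
have : ~ E N w by near: N.
rewrite /E /= => /negP; rewrite -leNgt; apply: le_trans.
rewrite ler_pdivlMr// mean_countE.
apply: (@le_trans _ _ (expR ((\sum_(i < n) u i) * N%:R))); last exact: prod_ge_expR.
have : 2 <= expR ((\sum_(i < n) u i - t) * N%:R).
  by near: N; apply: near_expR_ge; rewrite subr_gt0.
move=> /ler_wpM2l => /(_ (expR (t * N%:R)) (expR_ge0 _)) /le_trans; apply.
by rewrite -expRD ler_expR le_eqVlt; apply/orP; left; apply/eqP; ring.
Unshelve. all: by end_near. Qed.

End AlmostSure.

(** * Energies of a branch in a prescribed product of sets *)

Section Sums.
Context (R : realType) (n : nat).

Lemma sum_cst_le (D : pred 'I_n) (e : R) : 0 <= e -> \sum_(i < n | D i) e <= n%:R * e.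
Proof.
move=> e0; apply: (@le_trans _ _ (\sum_(i < n) e)).
  by rewrite [leRHS](bigID D)/= lerDl sumr_ge0.
by rewrite sumr_const card_ord mulr_natl.
Qed.

(** To distribute an error dl among at most n terms. *)
Lemma small_share (dl : R) : 0 < dl -> exists2 e : R, 0 < e & n%:R * e < dl.
Proof.
move=> d0; exists (dl / n.+1%:R); first by rewrite divr_gt0.
by rewrite mulrC mulrAC ltr_pdivrMr// ltr_pM2l// ltr_nat.
Qed.

(** If some J i0 is infinite, a huge r i0 makes up for r i = -1 elsewhere. *)
Lemma lt_sum_ereal (D : pred 'I_n) (J : 'I_n -> \bar R) (c : R) :
  (forall i, 0 <= J i)%E -> (c%:E < \sum_(i < n | D i) J i)%E ->
  exists2 r : 'I_n -> R, (forall i, (r i)%:E < J i)%E & c < \sum_(i < n | D i) r i.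
Proof.
move=> J0 cJ.
have [[i0 [Di0 Ji0]]|hn] := pselect (exists i, D i /\ J i = +oo%E).
  exists (fun i => if J i == +oo%E then `|c| + n%:R + 1 else -1).
    move=> i; case: eqP => [->|_]; first exact: ltry.
    by apply: lt_le_trans (J0 i); rewrite lte_fin ltrN10.
  rewrite (bigD1 i0)//= Ji0 eqxx.
  set S := \sum_(i < n | _) _.
  have : - (n%:R) <= S.
    apply: (@le_trans _ _ (\sum_(i < n | D i && (i != i0)) (-1))).
      rewrite sumrN lerN2 -[leRHS]mulr1; exact: sum_cst_le.
    apply: ler_sum => i _; case: ifP => // _.
    by have := normr_ge0 c; have := ler0n R n; lra.
  have := ler_norm c; lra.
have Jf i : D i -> J i = (fine (J i))%:E.
  move=> Di; rewrite fineK// ge0_fin_numE// ltey.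
  by apply/eqP => Ji; apply: hn; exists i.
move: cJ; rewrite (eq_bigr (fun i => (fine (J i))%:E))// sumEFin lte_fin -subr_gt0.
move=> /small_share[e e0 ne].
exists (fun i => fine (J i) - e).
  move=> i; case: (J i) (J0 i) => [x| |]//= _; last exact: ltry.
  by rewrite lte_fin gtrBl.
rewrite big_split /= sumrN; have := sum_cst_le D (ltW e0); lra.
Qed.

End Sums.

Section InfRate.
Context (R : realType) (n : nat) (I : 'I_n -> R -> \bar R) (B : 'I_n -> set R).

Definition inf_rate (i : 'I_n) : \bar R := ereal_inf [set I i x | x in B i].

Lemma inf_rate_ge0 i : (forall x, (0 <= I i x)%E) -> (0 <= inf_rate i)%E.
Proof. by move=> I0; apply: le_ereal_inf_tmp => _ [x _ <-]. Qed.

End InfRate.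

Section Cells.
Context (R : realType) (n : nat).
Context (dX : measure_display) (OmegaX : measurableType dX) (PX : probability OmegaX R).
Context (xi : nat -> seq nat -> {RV PX >-> R}).
Hypothesis hxi_sym : forall (N : nat) (s : seq nat), (n <= N)%N ->
     (0 < size s <= n)%N -> symmetric_rv (xi N s).
Hypothesis hxi_indep : forall N : nat, (n <= N)%N ->
     mutually_independent [set s : seq nat | (0 < size s <= n)%N] (xi N).
Hypothesis hxi_law : forall (N : nat) (s t : seq nat), (n <= N)%N ->
     (0 < size s <= n)%N -> size t = size s -> same_law (xi N s) (xi N t).
Context (I : 'I_n -> R -> \bar R).
Hypothesis hI_ldp : forall (i : 'I_n) (s : seq nat), size s = i.+1 ->
     ldp (fun N : nat =>
       distribution PX (measurable_realfun.scale_mfun N%:R^-1 (xi N s)))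
       (I i).
Context (l : 'I_n -> nat -> nat) (h : 'I_n -> R).
Hypothesis hl : forall i (e : R), 0 < e -> \forall N \near \oo,
   expR ((h i - e) * N%:R) <= (l i N).+1%:R <= expR ((h i + e) * N%:R).

(** The sign makes the weight of a branch increase with the rescaled energy.  A
    word whose length is not that of a node is left unconstrained; this gives
    the events at meaningless lengths probability 1. *)
Definition cell_vals (B : 'I_n -> set R) N (v : seq nat) : set R :=
  [set x | forall i : 'I_n, size v = i.+1 -> B i (- x / N%:R)].

Definition cell_event (B : 'I_n -> set R) N v : set OmegaX :=
  xi N v @^-1` cell_vals B N v.

(** The common probability at a level is read off at its leftmost node, the word
    of zeros. *)
Definition level_prob (B : 'I_n -> set R) N j : R :=
  fine (PX (cell_event B N (nseq j.+1 0%N))).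

Section FixB.
Variable B : 'I_n -> set R.
Hypothesis mB : forall i, measurable (B i).

Lemma measurable_cell_vals N v : measurable (cell_vals B N v).
Proof.
rewrite (_ : cell_vals B N v =
  \bigcap_(i in [set i : 'I_n | size v = i.+1]) ((fun x : R => - x / N%:R) @^-1` B i)).
  apply: fin_bigcap_measurable; first exact: finite_finset.
  move=> i _; rewrite -[X in measurable X]setTI.
  have mf : measurable_fun setT (fun x : R => - x / N%:R).
    by apply: measurable_funM => //; exact: measurableT_comp.
  exact: mf.
by apply/seteqP; split => x hx i; exact: hx.
Qed.

Lemma measurable_cell_event N v : measurable (cell_event B N v).
Proof. exact: (@measurable_funPTI _ _ _ _ (xi N v) _ (measurable_cell_vals N v)). Qed.

Lemma level_prob_ge0 N j : 0 <= level_prob B N j.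
Proof. exact/fine_ge0/measure_ge0. Qed.

Lemma level_prob_gt0 N j : (n <= j)%N -> 0 < level_prob B N j.
Proof.
move=> nj; rewrite /level_prob (_ : cell_event _ _ _ = setT) ?probability_setT//.
apply/seteqP; split => // w _ i; rewrite size_nseq => -[ji].
by have := ltn_ord i; rewrite -ji ltnNge nj.
Qed.

Lemma cell_event_law N v : (n <= N)%N -> (0 < size v <= n)%N ->
  fine (PX (cell_event B N v)) = level_prob B N (size v).-1.
Proof.
move=> nN hv; rewrite /level_prob prednK; last by case/andP: hv.
congr fine.
have -> : cell_event B N (nseq (size v) 0%N) =
    xi N (nseq (size v) 0%N) @^-1` cell_vals B N v.
  by rewrite /cell_event /cell_vals size_nseq.
have := hxi_law nN hv (size_nseq (size v) 0%N) (measurable_cell_vals N v).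
by [].
Qed.

Lemma cell_event_indep N (r : seq (seq nat)) : (n <= N)%N -> uniq r ->
  (forall v, v \in r -> (0 < size v <= n)%N) ->
  PX (\bigcap_(v in [set` r]) cell_event B N v) =
  (\prod_(v <- r) level_prob B N (size v).-1)%:E.
Proof.
move=> nN ur hr.
rewrite (hxi_indep nN ur)//; last by move=> v; exact: measurable_cell_vals.
by congr EFin; apply: eq_big_seq => v vr; rewrite -cell_event_law//; exact: hr.
Qed.

(** By symmetry of the energies, the sign in the events can be dropped. *)
Lemma level_probE N (i : 'I_n) : (n <= N)%N ->
  level_prob B N i = fine (distribution PX
    (measurable_realfun.scale_mfun N%:R^-1 (xi N (nseq i.+1 0%N))) (B i)).
Proof.
move=> nN; congr fine.
have mf : measurable_fun setT (fun x : R => x / N%:R) by exact: measurable_funM.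
have mS : measurable [set x : R | B i (x / N%:R)].
  by rewrite -[X in measurable X]setTI; exact: mf.
have hs : (0 < size (nseq i.+1 0%N) <= n)%N by rewrite size_nseq/=.
have := hxi_sym nN hs mS; rewrite /= => e.
transitivity (PX [set w | B i (- xi N (nseq i.+1 0%N) w / N%:R)]).
  congr (PX _); apply/seteqP; split => w /=; rewrite /cell_event /cell_vals /=.
    by apply; rewrite size_nseq.
  by move=> Bw j; rewrite size_nseq => -[/val_inj <-].
rewrite -e; by [].
Qed.

Local Notation lN N := (fun i => l i N).
Local Notation cnt N w := (num_occ R (@prefix_ev _ OmegaX n (lN N) (cell_event B N) n) w).

Lemma rate_ge0 i x : (0 <= I i x)%E.
Proof.
have : size (nseq i.+1 0%N) = i.+1 by rewrite size_nseq.
by move=> /hI_ldp [[]].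
Qed.

Lemma level_upper i (c e : R) : closed (B i) -> (c%:E < inf_rate I B i)%E -> 0 < e ->
  \forall N \near \oo, (l i N).+1%:R * level_prob B N i <= expR ((h i + e - c) * N%:R).
Proof.
move=> cB cJ e0.
have := ldp_upper (hI_ldp (size_nseq i.+1 0%N)) cB cJ => hu.
near=> N.
have nN : (n <= N)%N by near: N; exact: nbhs_infty_ge.
rewrite mulrBl expRD; apply: ler_pM => //; first exact: level_prob_ge0.
  have : expR ((h i - e) * N%:R) <= (l i N).+1%:R <= expR ((h i + e) * N%:R).
    by near: N; exact: hl.
  by case/andP.
by rewrite level_probE//; near: N.
Unshelve. all: by end_near. Qed.

Lemma level_lower i (c e : R) : open (B i) -> (inf_rate I B i < c%:E)%E -> 0 < e ->
  \forall N \near \oo, expR ((h i - e - c) * N%:R) <= (l i N).+1%:R * level_prob B N i.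
Proof.
move=> cB /ereal_inf_lt[_ [x Bx <-]] cJ e0.
have := ldp_lower (hI_ldp (size_nseq i.+1 0%N)) cB Bx cJ => hu.
near=> N.
have nN : (n <= N)%N by near: N; exact: nbhs_infty_ge.
rewrite mulrBl expRD; apply: ler_pM; rewrite ?expR_ge0//.
  have : expR ((h i - e) * N%:R) <= (l i N).+1%:R <= expR ((h i + e) * N%:R).
    by near: N; exact: hl.
  by case/andP.
by rewrite level_probE//; near: N.
Unshelve. all: by end_near. Qed.

Lemma cell_dead (k : 'I_n) : (forall i, closed (B i)) ->
  ((\sum_(i < n | (i <= k)%N) h i)%:E < \sum_(i < n | (i <= k)%N) inf_rate I B i)%E ->
  {ae PX, forall w, \forall N \near \oo, cnt N w = 0}.
Proof.
move=> cB /lt_sum_ereal[i|r rJ]; first exact/inf_rate_ge0/rate_ge0.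
rewrite -subr_gt0 => /(small_share n)[e e0 ne].
have : {ae PX, forall w, \forall N \near \oo,
    ~ exists s, @prefix_ev _ OmegaX n (lN N) (cell_event B N) k.+1 s w}.
  apply: (@ae_no_prefix R n _ _ PX l (cell_event B) (level_prob B)
    measurable_cell_event level_prob_ge0 cell_event_indep k.+1 (fun i => h i + e - r i)).
  - by move=> i _; exact: level_upper.
  - rewrite big_split big_split /= sumrN.
    have := sum_cst_le (fun i : 'I_n => (i < k.+1)%N) (ltW e0).
    move: ne; set a := \sum_(_ < n | _) r _; set b := \sum_(_ < n | _) h _.
    rewrite -[X in _ -> _ -> _ + _ - X < _]/a -[X in _ -> _ -> X + _ - _ < _]/b.
    lra.
apply: filterS => w; apply: filterS => N hN.
rewrite /num_occ big1// => s _; rewrite indicE memNset// => hs; apply: hN; exists s.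
by apply/prefix_evP => i ik; move/prefix_evP : hs; apply; exact: ltn_ord.
Qed.

Lemma cell_alive (j : 'I_n -> R) (e : R) : (forall i, closed (B i)) ->
  (forall i, inf_rate I B i = (j i)%:E) -> 0 < e ->
  {ae PX, forall w, \forall N \near \oo,
    cnt N w <= expR ((\sum_(i < n) (h i - j i) + e) * N%:R)}.
Proof.
move=> cB hj e0.
have e20 : 0 < e / 2 by rewrite divr_gt0.
have [e' e'0 ne] := small_share n e20.
apply: (@ae_count_upper R n _ _ PX l (cell_event B) (level_prob B)
  measurable_cell_event level_prob_ge0 cell_event_indep (fun i => h i + e' - (j i - e'))).
- by move=> i; apply: level_upper => //; rewrite hj lte_fin gtrBl.
- rewrite (eq_bigr (fun i => (h i - j i) + (e' + e'))); last by move=> i _; ring.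
  rewrite big_split /= [X in _ + X]big_split/=.
  have := sum_cst_le (fun i : 'I_n => true) (ltW e'0); lra.
Qed.

Lemma cell_open (j : 'I_n -> R) (e : R) : (forall i, open (B i)) ->
  (forall i, inf_rate I B i = (j i)%:E) -> 0 < e ->
  (forall k : 'I_n, \sum_(i < n | (i <= k)%N) j i < \sum_(i < n | (i <= k)%N) h i) ->
  {ae PX, forall w, \forall N \near \oo,
    expR ((\sum_(i < n) (h i - j i) - e) * N%:R) <= cnt N w}.
Proof.
move=> cB hj e0 hk.
pose g (k : 'I_n) := \sum_(i < n | (i <= k)%N) h i - \sum_(i < n | (i <= k)%N) j i.
pose dl := \big[Order.min/e]_(k < n) g k.
have dl0 : 0 < dl / 2.
  rewrite divr_gt0//; apply: (big_ind (fun x => 0 < x)) => // [x y x0 y0|k _].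
    by rewrite lt_min x0.
  by rewrite /g subr_gt0.
have [e' e'0 ne] := small_share n dl0.
have S (D : pred 'I_n) : \sum_(i < n | D i) (h i - e' - (j i + e')) >
    \sum_(i < n | D i) h i - \sum_(i < n | D i) j i - dl.
  have -> : \sum_(i < n | D i) (h i - e' - (j i + e')) =
      \sum_(i < n | D i) h i - \sum_(i < n | D i) j i -
      (\sum_(i < n | D i) e' + \sum_(i < n | D i) e').
    by rewrite -big_split -!sumrB /=; apply: eq_bigr => i _; ring.
  have := sum_cst_le D (ltW e'0); lra.
apply: (@ae_count_lower R n _ _ PX l (cell_event B) (level_prob B)
  measurable_cell_event level_prob_ge0 cell_event_indep (fun i => h i - e' - (j i + e'))).
- by move=> N k; exact: level_prob_gt0.
- by move=> i; apply: level_lower => //; rewrite hj lte_fin ltrDl.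
- move=> k kn; apply: le_lt_trans (S _).
  have := @bigmin_le _ _ _ e (Ordinal kn) g; rewrite -/dl /g /=; lra.
- apply: le_lt_trans (S _).
  have := @bigmin_le_id _ _ _ (index_enum 'I_n) e xpredT g; rewrite -/dl sumrB; lra.
Qed.

End FixB.

End Cells.

(** * A grid of cells covering a cube *)

Section Grid.
Context (R : realType).
Implicit Types (M x : R) (m j : nat).

Definition grid M m j : R := - M + j%:R / m.+1%:R.
Definition grid_size M m : nat := (Num.truncn (2 * M * m.+1%:R)).+1.

Lemma grid_cover M m x : `|x| <= M ->
  exists j : 'I_(grid_size M m), grid M m j <= x <= grid M m j + m.+1%:R^-1.
Proof.
rewrite ler_norml => /andP[Mx xM].
have y0 : 0 <= (x + M) * m.+1%:R by rewrite mulr_ge0//; lra.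
have /andP[h1 h2] := truncn_itv y0.
set j := Num.truncn _ in h1 h2.
have jK : (j < grid_size M m)%N.
  rewrite /grid_size ltnS; apply: le_truncn.
  by rewrite ler_wpM2r//; lra.
exists (Ordinal jK) => /=; rewrite /grid.
have m0 : 0 < m.+1%:R :> R by [].
move: h1 h2; rewrite -ler_pdivrMr// -[j.+1%:R]natr1 -ltr_pdivlMr// mulrDl div1r.
move: (j%:R / m.+1%:R : R) (m.+1%:R^-1 : R) => u v h1 h2; apply/andP; split; lra.
Qed.

Definition closed_cell M m n (c : {ffun 'I_n -> 'I_(grid_size M m)}) (i : 'I_n) : set R :=
  `[grid M m (c i) - m.+1%:R^-1, grid M m (c i) + m.+1%:R^-1]%classic.

Definition open_cell M m n (c : {ffun 'I_n -> 'I_(grid_size M m)}) (i : 'I_n) : set R :=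
  `]grid M m (c i) - 2 / m.+1%:R, grid M m (c i) + 2 / m.+1%:R[%classic.

Lemma closed_cell_closed M m n c i : closed (@closed_cell M m n c i).
Proof. exact: interval_closed. Qed.

Lemma open_cell_open M m n c i : open (@open_cell M m n c i).
Proof. exact: interval_open. Qed.

Lemma cell_cover M m n (x : 'I_n -> R) : (forall i, `|x i| <= M) ->
  exists c : {ffun 'I_n -> 'I_(grid_size M m)},
    (forall i, closed_cell c i (x i)) /\ forall i, open_cell c i (x i).
Proof.
move=> hx; have /choice[c hc] : forall i, exists j : 'I_(grid_size M m),
   grid M m j <= x i <= grid M m j + m.+1%:R^-1.
  by move=> i; apply: grid_cover.
have m0 : 0 < m.+1%:R^-1 :> R by rewrite invr_gt0.
exists [ffun i => c i]; split => i; have := hc i;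
  rewrite /closed_cell /open_cell /= in_itv/= !ffunE; move: m0;
  move: (grid _ _ _) (_^-1) => u v v0 /andP[h1 h2]; apply/andP; split; lra.
Qed.

End Grid.

(** * The variational problem and the Laplace principle *)

Section Variational.
Context (R : realType) (n : nat) (I : 'I_n -> R -> \bar R) (p a : 'I_n -> R) (beta : R).
Hypothesis I0 : forall i x, (0 <= I i x)%E.
Hypothesis gI : forall i, good (I i).
Hypothesis sqcI : forall i, strictly_quasi_convex (I i).
Hypothesis hp : forall i, 0 < p i.
Hypothesis ha : forall i, 0 < a i.
Hypothesis b0 : 0 < beta.
Context (x0 : 'I_n -> R).
Hypothesis hx0 : forall i, I i (x0 i) = 0%E.
Context (M : R).
Local Notation h i := (p i * ln 2).
Hypothesis hM : forall i x, (I i x <= (\sum_(i < n) h i)%:E)%E -> `|x| <= M.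

Definition objective_values : set (\bar R) :=
  [set \sum_(i < n) (I i (x ord0 i) - (beta * a i * x ord0 i)%:E) | x in Psi p I]%E.

Lemma entropy_gt0 i : 0 < h i.
Proof. by rewrite mulr_gt0// ln_gt0// ltr1n. Qed.

(** Membership in Psi, for plain functions instead of row vectors. *)
Definition admissible (x : 'I_n -> R) := forall k : 'I_n,
  (\sum_(i < n | (i <= k)%N) I i (x i) <= (\sum_(i < n | (i <= k)%N) h i)%:E)%E.

Definition value (x : 'I_n -> R) : R := \sum_(i < n) (fine (I i (x i)) - beta * a i * x i).

Lemma admissible_le (x : 'I_n -> R) i : admissible x -> (I i (x i) <= (\sum_(i < n) h i)%:E)%E.
Proof.
move=> hx; apply: (@le_trans _ _ (\sum_(j < n | (j <= i)%N) I j (x j))%E).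
  by rewrite (bigD1 i)//= leeDl// sume_ge0.
apply: le_trans (hx i) _; rewrite lee_fin.
rewrite [leRHS](bigID (fun j : 'I_n => (j <= i)%N))/= lerDl sumr_ge0// => j _.
exact/ltW/entropy_gt0.
Qed.

Lemma admissible_fin (x : 'I_n -> R) i : admissible x -> I i (x i) \is a fin_num.
Proof. by move=> /(admissible_le i) hx; rewrite ge0_fin_numE// (le_lt_trans hx)// ltry. Qed.

Lemma admissible_bound (x : 'I_n -> R) i : admissible x -> `|x i| <= M.
Proof. by move=> /(admissible_le i); exact: hM. Qed.

Lemma objective_valuesE : objective_values = [set (value x)%:E | x in admissible].
Proof.
have e (x : 'I_n -> R) : admissible x ->
    (\sum_(i < n) (I i (x i) - (beta * a i * x i)%:E))%E = (value x)%:E.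
  move=> hx; rewrite /value -sumEFin; apply: eq_bigr => i _.
  by rewrite EFinB fineK// admissible_fin.
apply/seteqP; split => [_ [x hx <-]|_ [x hx <-]].
  by exists (fun i => x ord0 i); rewrite ?e.
exists (\row_i x i); first by move=> k; under eq_bigr do rewrite mxE; exact: hx.
by under eq_bigr do rewrite mxE; rewrite e.
Qed.

Lemma admissible_x0 : admissible x0.
Proof.
move=> k; rewrite big1 => [|i _]; last exact: hx0.
by rewrite lee_fin sumr_ge0// => i _; exact/ltW/entropy_gt0.
Qed.

Lemma inf_objective_fin : ereal_inf objective_values \is a fin_num.
Proof.
rewrite objective_valuesE fin_numE; apply/andP; split.
- rewrite gt_eqF//; apply: (@lt_le_trans _ _ (\sum_(i < n) (- (beta * a i * M)))%:E).
    exact: ltNyr.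
  apply: le_ereal_inf_tmp => _ [x hx <-]; rewrite lee_fin; apply: ler_sum => i _.
  have := fine_ge0 (I0 i (x i)).
  have := admissible_bound i hx; rewrite ler_norml => /andP[_ xM].
  have : beta * a i * x i <= beta * a i * M by rewrite ler_wpM2l// mulr_ge0 ?ltW.
  lra.
- rewrite lt_eqF//; apply: (@le_lt_trans _ _ (value x0)%:E); last exact: ltry.
  by apply: ereal_inf_lbound; exists x0 => //; exact: admissible_x0.
Qed.

Lemma value_ge (x : 'I_n -> R) : admissible x -> fine (ereal_inf objective_values) <= value x.
Proof.
move=> hx; rewrite -lee_fin fineK ?inf_objective_fin//.
by apply: ereal_inf_lbound; rewrite objective_valuesE; exists x.
Qed.

(** The point y is x moved by a fraction s towards x0.  No rate increases, and a
    rate which moves decreases; the linear part of the objective changes by at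
    most s C. *)
Lemma strictly_admissible_near_optimal (e : R) : 0 < e -> exists y : 'I_n -> R,
  [/\ admissible y, value y < fine (ereal_inf objective_values) + e &
    forall k : 'I_n, \sum_(i < n | (i <= k)%N) fine (I i (y i)) < \sum_(i < n | (i <= k)%N) h i].
Proof.
move=> e0.
have e20 : 0 < e / 2 by rewrite divr_gt0.
have : (ereal_inf objective_values < (fine (ereal_inf objective_values) + e / 2)%:E)%E.
  by rewrite EFinD fineK ?inf_objective_fin// lteDl// ?inf_objective_fin// lte_fin.
rewrite {1}objective_valuesE => /ereal_inf_lt[_ [x hx <-]]; rewrite lte_fin => vx.
pose C := \sum_(i < n) (beta * a i * `|x i - x0 i|).
have C0 : 0 <= C by apply: sumr_ge0 => i _; rewrite mulr_ge0// mulr_ge0 ?ltW.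
pose s := e / 2 / (C + e).
have Ce : 0 < C + e by lra.
have s0 : 0 < s by rewrite divr_gt0.
have s1 : s < 1 by rewrite ltr_pdivrMr//; lra.
have sC : s * C <= e / 2.
  rewrite /s mulrAC ler_pdivrMr//; nra.
pose y i := (1 - s) * x i + (1 - (1 - s)) * x0 i.
have yx i : (I i (y i) <= I i (x i))%E /\ (x i != x0 i -> (I i (y i) < I i (x i))%E).
  have xf := admissible_fin i hx.
  have [xx|xx] := eqVneq (x i) (x0 i).
    by split => //; rewrite /y -xx (_ : _ + _ = x i)//; ring.
  suff H : (I i (y i) < I i (x i))%E by split => //; exact: ltW.
  have := @sqcI i (x i) (x0 i) (1 - s) xx.
  rewrite hx0 ltry -ge0_fin_numE// xf => /(_ isT isT).
  have -> : 0 < 1 - s < 1 by apply/andP; split; lra.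
  by move=> /(_ isT); rewrite max_l.
have hy : admissible y.
  by move=> k; apply: le_trans (hx k); apply: lee_sum => i _; case: (yx i).
have fyx i : fine (I i (y i)) <= fine (I i (x i)).
  by apply: fine_le; [exact: admissible_fin|exact: admissible_fin|case: (yx i)].
exists y; split => //.
- suff : value y <= value x + s * C by lra.
  rewrite /value mulr_sumr -big_split /=; apply: ler_sum => i _.
  have := fyx i; rewrite /y.
  have := ler_norm (x i - x0 i); set d := `|_| => hd.
  have bd : 0 <= beta * a i * s * (d - (x i - x0 i)).
    by apply: mulr_ge0; [apply: mulr_ge0; [apply: mulr_ge0|]; exact: ltW|rewrite subr_ge0].
  nra.
- move=> k.
  have [[i [ik xi]]|hn] := pselect (exists i : 'I_n, (i <= k)%N /\ x i != x0 i).
    apply: (@lt_le_trans _ _ (\sum_(i < n | (i <= k)%N) fine (I i (x i)))).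
      rewrite (bigD1 i)//= [ltRHS](bigD1 i)//=; apply: ltr_leD; last by apply: ler_sum.
      by rewrite fine_lt ?admissible_fin//; case: (yx i) => _; exact.
    rewrite -lee_fin -sumEFin; apply: le_trans (hx k).
    by apply: lee_sum => j _; rewrite fineK// admissible_fin.
  apply: (@le_lt_trans _ _ 0).
    rewrite le_eqVlt; apply/orP; left; apply/eqP; rewrite big1// => i ik.
    have [xx|xx] := eqVneq (x i) (x0 i); last by exfalso; apply: hn; exists i.
    by rewrite /y xx (_ : _ + _ = x0 i) ?hx0//; ring.
  rewrite (bigD1 k)//= ltr_wpDr ?entropy_gt0// sumr_ge0// => i _; exact/ltW/entropy_gt0.
Qed.


(** From here on, X stands for one realization of the rescaled energies, along an
    arbitrary sequence of finite sets of configurations. *)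
Section Configurations.
Context (S : nat -> finType) (X : forall N, S N -> 'I_n -> R).

Definition count_in N (B : 'I_n -> set R) : R :=
  \sum_(s : S N) (`[< forall i, B i (X s i) >])%:R.

Definition partition_sum N : R :=
  \sum_(s : S N) expR (N%:R * \sum_(i < n) beta * a i * X s i).

Definition mesh (m : nat) : R := m.+1%:R^-1.

(** The three counting estimates, as properties of one realization; they hold
    almost surely by ae_cells. *)
Definition dead_cells m := forall (c : {ffun 'I_n -> 'I_(grid_size M m)}) (k : 'I_n),
  ((\sum_(i < n | (i <= k)%N) h i)%:E <
     \sum_(i < n | (i <= k)%N) inf_rate I (closed_cell c) i)%E ->
  \forall N \near \oo, count_in N (closed_cell c) = 0.

Definition alive_cells m := forall (c : {ffun 'I_n -> 'I_(grid_size M m)}),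
  (forall i, inf_rate I (closed_cell c) i \is a fin_num) ->
  \forall N \near \oo, count_in N (closed_cell c) <=
    expR ((\sum_(i < n) (h i - fine (inf_rate I (closed_cell c) i)) + mesh m) * N%:R).

Definition open_cells m := forall (c : {ffun 'I_n -> 'I_(grid_size M m)}),
  (forall i, inf_rate I (open_cell c) i \is a fin_num) ->
  (forall k : 'I_n, \sum_(i < n | (i <= k)%N) fine (inf_rate I (open_cell c) i) <
     \sum_(i < n | (i <= k)%N) h i) ->
  \forall N \near \oo,
    expR ((\sum_(i < n) (h i - fine (inf_rate I (open_cell c) i)) - mesh m) * N%:R) <=
    count_in N (open_cell c).

Local Notation f := (fine (ereal_inf objective_values)).
Local Notation L := (\sum_(i < n) h i).
Local Notation wsum := (\sum_(i < n) beta * a i).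

Lemma mesh_gt0 m : 0 < mesh m.
Proof. by rewrite invr_gt0. Qed.

Lemma wsum_ge0 : 0 <= wsum.
Proof. by apply: sumr_ge0 => i _; rewrite mulr_ge0 ?ltW. Qed.

(** The point of Psi to compare with is a minimizer of the rates over the cell;
    its coordinates are within 2 mesh of the right ends of the cell. *)
Lemma cell_contribution m (c : {ffun 'I_n -> 'I_(grid_size M m)}) :
  dead_cells m -> alive_cells m ->
  \forall N \near \oo, count_in N (closed_cell c) *
     expR (N%:R * \sum_(i < n) beta * a i * (grid M m (c i) + mesh m)) <=
     expR ((L - f + (1 + 2 * wsum) * mesh m) * N%:R).
Proof.
move=> hd hv.
have [[k hk]|hn] := pselect (exists k : 'I_n, ((\sum_(i < n | (i <= k)%N) h i)%:E <
     \sum_(i < n | (i <= k)%N) inf_rate I (closed_cell c) i)%E).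
  have := hd c k hk; apply: filterS => N ->.
  by rewrite mul0r expR_ge0.
have hJ (k : 'I_n) : (\sum_(i < n | (i <= k)%N) inf_rate I (closed_cell c) i <=
    (\sum_(i < n | (i <= k)%N) h i)%:E)%E.
  by rewrite leNgt; apply/negP => hk; apply: hn; exists k.
have Jf i : inf_rate I (closed_cell c) i \is a fin_num.
  rewrite ge0_fin_numE ?inf_rate_ge0//; apply: le_lt_trans (ltry _); apply: le_trans (hJ i).
  rewrite (bigD1 i)//= leeDl// sume_ge0// => j _; exact: inf_rate_ge0.
have /choice[x hx] i : exists x, closed_cell c i x /\ I i x = inf_rate I (closed_cell c) i.
  have [] := good_inf_attained (@gI i) (I0 i) (@closed_cell_closed _ _ _ _ c i).
    by have := Jf i; rewrite ge0_fin_numE// inf_rate_ge0.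
  by move=> x cx Ix; exists x.
have ax : admissible x.
  by move=> k; apply: le_trans (hJ k); apply: lee_sum => i _; rewrite (hx i).2.
have := value_ge ax; rewrite /value => fv.
have := hv c Jf; apply: filterS => N hN.
apply: le_trans (ler_wpM2r (expR_ge0 _) hN) _.
rewrite -expRD ler_expR [N%:R * _]mulrC -mulrDl ler_wpM2r//.
have step : \sum_(i < n) beta * a i * (grid M m (c i) + mesh m) <=
    \sum_(i < n) beta * a i * x i + 2 * wsum * mesh m.
  rewrite mulrAC mulr_sumr -big_split /=; apply: ler_sum => i _.
  have := (hx i).1; rewrite /closed_cell /= in_itv/= -/(mesh m) => /andP[h1 _].
  rewrite [2 * _ * _]mulrC -mulrDr ler_wpM2l//; first by rewrite mulr_ge0// ltW.
  lra.
move: fv step; rewrite !sumrB.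
have -> : \sum_(i < n) fine (I i (x i)) = \sum_(i < n) fine (inf_rate I (closed_cell c) i).
  by apply: eq_bigr => i _; rewrite (hx i).2.
lra.
Qed.

Lemma partition_upper m : (\forall N \near \oo, forall (s : S N) i, `|X s i| <= M) ->
  dead_cells m -> alive_cells m ->
  \forall N \near \oo, partition_sum N <= expR ((L - f + (2 + 2 * wsum) * mesh m) * N%:R).
Proof.
move=> hX hd hv.
pose C := {ffun 'I_n -> 'I_(grid_size M m)}.
near=> N.
have hXN : forall (s : S N) i, `|X s i| <= M by near: N.
have hC : forall c : C, count_in N (closed_cell c) *
     expR (N%:R * \sum_(i < n) beta * a i * (grid M m (c i) + mesh m)) <=
     expR ((L - f + (1 + 2 * wsum) * mesh m) * N%:R).
  by near: N; apply: filter_forall => c; exact: cell_contribution.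
have hcard : #|C|%:R <= expR (mesh m * N%:R).
  by near: N; apply: near_expR_ge; exact: mesh_gt0.
apply: (@le_trans _ _ (\sum_(c : C) count_in N (closed_cell c) *
     expR (N%:R * \sum_(i < n) beta * a i * (grid M m (c i) + mesh m)))).
  rewrite /partition_sum /count_in.
  under [leRHS]eq_bigr do rewrite mulr_suml.
  rewrite exchange_big /=; apply: ler_sum => s _.
  have [c [hc _]] := cell_cover m (hXN s).
  rewrite (bigD1 c)//= asboolT// mul1r -[leLHS]addr0; apply: lerD; last first.
    by apply: sumr_ge0 => c' _; rewrite mulr_ge0// expR_ge0.
  rewrite ler_expR ler_wpM2l//; apply: ler_sum => i _.
  rewrite ler_wpM2l//; first by rewrite mulr_ge0 ?ltW.
  by have := hc i; rewrite /closed_cell /= in_itv/= => /andP[].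
apply: le_trans (ler_sum _ (fun c _ => hC c)) _.
rewrite sumr_const -[leLHS]mulr_natl.
apply: le_trans (ler_wpM2r (expR_ge0 _) hcard) _.
by rewrite -expRD ler_expR -mulrDl ler_wpM2r//; lra.
Unshelve. all: by end_near. Qed.

(** Both y and the energies of a branch counted in the open cell are within
    2 mesh of its centre, whence the 4. *)
Lemma partition_lower m (e : R) : 0 < e -> open_cells m ->
  \forall N \near \oo, expR ((L - f - e - (1 + 4 * wsum) * mesh m) * N%:R) <= partition_sum N.
Proof.
move=> e0 ho.
have [y [ay vy sy]] := strictly_admissible_near_optimal e0.
have [c [_ hc]] := cell_cover m (fun i => admissible_bound i ay).
have Jy i : (inf_rate I (open_cell c) i <= I i (y i))%E.
  by apply: ereal_inf_lbound; exists (y i).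
have Jf i : inf_rate I (open_cell c) i \is a fin_num.
  rewrite ge0_fin_numE ?inf_rate_ge0//; apply: le_lt_trans (Jy i) _.
  by rewrite -ge0_fin_numE// admissible_fin.
have fJ i : fine (inf_rate I (open_cell c) i) <= fine (I i (y i)).
  by apply: fine_le => //; exact: admissible_fin.
have := ho c Jf; case.
  by move=> k; apply: le_lt_trans (sy k); apply: ler_sum.
move=> N0 _ hN; exists N0 => // N N0N.
have {}hN := hN N N0N.
apply: (@le_trans _ _ (count_in N (open_cell c) *
   expR (N%:R * \sum_(i < n) beta * a i * (y i - 4 * mesh m)))).
  apply: le_trans (ler_wpM2r (expR_ge0 _) hN).
  rewrite -expRD ler_expR [N%:R * _]mulrC -mulrDl ler_wpM2r//.
  have -> : \sum_(i < n) beta * a i * (y i - 4 * mesh m) =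
      \sum_(i < n) beta * a i * y i - 4 * wsum * mesh m.
    rewrite mulrAC mulr_sumr -sumrB; apply: eq_bigr => i _; ring.
  have : \sum_(i < n) fine (inf_rate I (open_cell c) i) <= \sum_(i < n) fine (I i (y i)).
    exact: ler_sum.
  move: vy; rewrite /value !sumrB.
  lra.
rewrite /count_in mulr_suml; apply: ler_sum => s _.
case: asboolP => [hs|_]; last by rewrite mul0r expR_ge0.
rewrite mul1r ler_expR ler_wpM2l//; apply: ler_sum => i _.
rewrite ler_wpM2l//; first by rewrite mulr_ge0 ?ltW.
have := hs i; have := hc i; rewrite /open_cell /= !in_itv/= -/(mesh m).
move=> /andP[_ h1] /andP[h2 _]; lra.
Qed.

Lemma partition_limit : (\forall N \near \oo, forall (s : S N) i, `|X s i| <= M) ->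
  (forall m, dead_cells m) -> (forall m, alive_cells m) -> (forall m, open_cells m) ->
  (fun N : nat => (N%:R^-1 * ln (partition_sum N))%:E) @ \oo -->
    (L%:E - ereal_inf objective_values)%E.
Proof.
move=> hX hd hv ho.
rewrite -[ereal_inf _]fineK ?inf_objective_fin// -EFinB.
apply: cvg_EFin; first exact: nearW.
apply/cvgrPdist_le => e e0.
have e30 : 0 < e / 3 by rewrite divr_gt0.
pose K := 2 + 4 * wsum.
have K0 : 0 < K by have := wsum_ge0; rewrite /K; lra.
have [m _ hm] := near_infty_natSinv_lt (PosNum (divr_gt0 e30 K0)).
have mK : K * mesh m <= e / 3.
  have := hm m (leqnn m); rewrite /= -/(mesh m) => /ltW.
  by rewrite ler_pdivlMr// mulrC.
have := partition_upper hX (hd m) (hv m).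
have := partition_lower e30 (ho m).
move=> hlo hup; near=> N.
have N0 : 0 < N%:R :> R by rewrite ltr0n; near: N; exact: nbhs_infty_gt.
have h1 : expR ((L - f - e / 3 - (1 + 4 * wsum) * mesh m) * N%:R) <= partition_sum N by near: N.
have h2 : partition_sum N <= expR ((L - f + (2 + 2 * wsum) * mesh m) * N%:R) by near: N.
have Z0 : 0 < partition_sum N by exact: lt_le_trans (expR_gt0 _) h1.
move: h1 h2; rewrite -ler_ln ?posrE ?expR_gt0// expRK => h1.
rewrite -ler_ln ?posrE ?expR_gt0// expRK => h2.
have := wsum_ge0; have := mesh_gt0 m => m0 s0.
have sm : 0 <= wsum * mesh m by rewrite mulr_ge0// ltW.
rewrite -ler_pdivlMr// [leRHS]mulrC in h1.
rewrite -ler_pdivrMr// [leLHS]mulrC in h2.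
rewrite /K in mK; rewrite ler_distl /=.
move: (_ * ln _) h1 h2 => v h1 h2; apply/andP; split; lra.
Unshelve. all: by end_near. Qed.

End Configurations.

End Variational.

(** * Growth of the random tree *)

Section TreeGrowth.
Context (R : realType) (d : measure_display) (T : measurableType d) (P : probability T R).
Context (k : nat -> nat) (p : R) (X : nat -> {RV P >-> nat}) (n : nat).
Hypothesis hp : 0 < p.
Hypothesis hk : (fun N : nat => (k N)%:R / N%:R : R) @ \oo --> p.
Hypothesis hX : forall N, (n <= N)%N -> poisson_rv (X N) (2 ^+ k N).

(** Since k N >= (p/2) N eventually and 2^k >= k, the Poisson tails
    exp (- 2^k / 4) are at most exp (- p N / 8). *)
Lemma ae_poisson_two_sided :
  {ae P, forall w, \forall N \near \oo, (2 ^ k N <= 4 * (X N w).+1 <= 16 * 2 ^ k N)%N}.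
Proof.
have tail : \forall N \near \oo, expR (- (2 ^+ k N / 4)) <= 1 * expR (- (p / 8 * N%:R)) :> R.
  move/cvgrPdist_le : hk => /(_ (p / 2)); rewrite divr_gt0// => /(_ isT) hk2.
  near=> N; rewrite mul1r ler_expR lerN2.
  have N0 : 0 < N%:R :> R by rewrite ltr0n; near: N; exact: nbhs_infty_gt.
  have : `|p - (k N)%:R / N%:R| <= p / 2 by near: N.
  rewrite ler_distl => /andP[_]; rewrite -lerBlDr ler_pdivlMr// => h1.
  have : (k N)%:R <= 2 ^+ k N :> R by rewrite -natrX ler_nat ltnW// ltn_expl.
  lra.
have h1 : {ae P, forall w, \forall N \near \oo, ~ (X N @^-1` [set j | (4 * j <= 2 ^ k N)%N]) w}.
  apply: (@borel_cantelli_exp _ _ _ P _ 1 (p / 8)); rewrite ?divr_gt0//.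
    by move=> N; exact: measurable_funPTI.
  near=> N; apply: le_trans (poisson_lower (hX _)) _.
    by near: N; exact: nbhs_infty_ge.
  by rewrite lee_fin; near: N.
have h2 : {ae P, forall w, \forall N \near \oo, ~ (X N @^-1` [set j | (4 * 2 ^ k N <= j)%N]) w}.
  apply: (@borel_cantelli_exp _ _ _ P _ 1 (p / 8)); rewrite ?divr_gt0//.
    by move=> N; exact: measurable_funPTI.
  near=> N; apply: le_trans (poisson_upper (hX _)) _.
    by near: N; exact: nbhs_infty_ge.
  by rewrite lee_fin; near: N.
move: h1 h2; apply: filterS2 => w; apply: filterS2 => N /= /negP; rewrite -ltnNge => h1 /negP.
rewrite -ltnNge => h2; apply/andP; split.
  by apply: leq_trans (ltnW h1) _; rewrite leq_mul2l leqnSn orbT.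
by rewrite -[16%N]/(4 * 4)%N -mulnA leq_mul2l.
Unshelve. all: by end_near. Qed.

Lemma ae_poisson_growth :
  {ae P, forall w, forall e : R, 0 < e -> \forall N \near \oo,
    expR ((p * ln 2 - e) * N%:R) <= (X N w).+1%:R <= expR ((p * ln 2 + e) * N%:R)}.
Proof.
move: ae_poisson_two_sided; apply: filterS => w hw e e0.
have ln20 : 0 < ln 2 :> R by rewrite ln_gt0// ltr1n.
have ln21 : ln 2 <= 1 :> R.
  by have := @le_ln1Dx R 1; rewrite (_ : 1 + 1 = 2)//; apply; lra.
have e20 : 0 < e / 2 by rewrite divr_gt0.
move/cvgrPdist_le : hk => /(_ _ e20) hk2.
near=> N.
have N0 : 0 < N%:R :> R by rewrite ltr0n; near: N; exact: nbhs_infty_gt.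
have : `|p - (k N)%:R / N%:R| <= e / 2 by near: N.
rewrite ler_distl => /andP[]; rewrite lerBlDr => h1 h2.
have Ek : (2 : R) ^+ k N = expR (ln 2 * (k N)%:R) by rewrite expRM_natr lnK// posrE.
have /andP[g1 g2] : (2 ^ k N <= 4 * (X N w).+1 <= 16 * 2 ^ k N)%N by near: N.
have h4 : 4 <= expR (e / 2 * N%:R) by near: N; exact: near_expR_ge.
have kN : (k N)%:R = (k N)%:R / N%:R * N%:R :> R by rewrite divfK ?gt_eqF.
set r : R := (k N)%:R / N%:R in h1 h2 kN.
have rl1 : ln 2 * r <= ln 2 * p + e / 2 by nra.
have rl2 : ln 2 * p - e / 2 <= ln 2 * r by nra.
apply/andP; split.
  have : 2 ^+ k N <= 4 * (X N w).+1%:R :> R by rewrite -natrX -natrM ler_nat.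
  rewrite Ek => g.
  have a1 : expR ((p * ln 2 - e) * N%:R) * expR (e / 2 * N%:R) <= 4 * (X N w).+1%:R.
    apply: le_trans g; rewrite -expRD ler_expR kN; nra.
  have := expR_gt0 ((p * ln 2 - e) * N%:R); nra.
have : (X N w).+1%:R <= 4 * 2 ^+ k N :> R.
  by rewrite -natrX -natrM ler_nat -(leq_pmul2l (isT : 0 < 4)%N) mulnA.
rewrite Ek => g; apply: le_trans g _.
apply: le_trans (ler_wpM2r (expR_ge0 _) h4) _.
rewrite -expRD ler_expR kN; nra.
Unshelve. all: by end_near. Qed.

End TreeGrowth.

(** * The limit for a fixed tree sequence *)

Lemma ae_imply d (T : measurableType d) (R : realType) (P : probability T R) (A : Prop)
  (B : T -> Prop) : (A -> {ae P, forall w, B w}) -> {ae P, forall w, A -> B w}.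
Proof.
have [a|na] := pselect A => h; first by apply: filterS (h a) => w.
by apply: aeW => w.
Qed.

Section Quenched.
Context (R : realType) (n : nat).
Context (dX : measure_display) (OmegaX : measurableType dX) (PX : probability OmegaX R).
Context (xi : nat -> seq nat -> {RV PX >-> R}).
Hypothesis hxi_sym : forall (N : nat) (s : seq nat), (n <= N)%N ->
     (0 < size s <= n)%N -> symmetric_rv (xi N s).
Hypothesis hxi_indep : forall N : nat, (n <= N)%N ->
     mutually_independent [set s : seq nat | (0 < size s <= n)%N] (xi N).
Hypothesis hxi_law : forall (N : nat) (s t : seq nat), (n <= N)%N ->
     (0 < size s <= n)%N -> size t = size s -> same_law (xi N s) (xi N t).
Context (I : 'I_n -> R -> \bar R).
Hypothesis hI_ldp : forall (i : 'I_n) (s : seq nat), size s = i.+1 ->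
     ldp (fun N : nat =>
       distribution PX (measurable_realfun.scale_mfun N%:R^-1 (xi N s)))
       (I i).
Context (l : 'I_n -> nat -> nat) (p : 'I_n -> R).
Hypothesis hp : forall i, 0 < p i.
Local Notation h i := (p i * ln 2).
Hypothesis hl : forall i (e : R), 0 < e -> \forall N \near \oo,
   expR ((h i - e) * N%:R) <= (l i N).+1%:R <= expR ((h i + e) * N%:R).

Definition branches N : finType := {dffun forall i : 'I_n, 'I_(l i N).+1}.
Definition energies (w : OmegaX) N (s : branches N) (i : 'I_n) : R :=
  - xi N (node s i) w / N%:R.

Lemma num_occ_count_in N (B : 'I_n -> set R) w :
  num_occ R (@prefix_ev _ OmegaX n (fun i => l i N) (cell_event xi B N) n) w =
  count_in (energies w) N B.
Proof.
apply: eq_bigr => s _; rewrite indicE; congr (nat_of_bool _)%:R.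
apply/idP/asboolP => [|hs].
  rewrite inE => /prefix_evP hs i; have := hs i (ltn_ord i).
  by rewrite /cell_event /cell_vals /=; apply; rewrite size_node.
rewrite inE; apply/prefix_evP => i _; rewrite /cell_event /cell_vals /= => j.
by rewrite size_node => -[/val_inj <-]; exact: hs.
Qed.

(** The complement of the interval of radius M i has so large a rate that its
    product with the whole line at the other levels is a dead cell: the prefixes
    of length i + 1 have a negative exponent. *)
Lemma ae_energies_confined (M : 'I_n -> R) i :
  (forall x, (I i x <= (\sum_(j < n) h j + 1)%:E)%E -> `|x| < M i) ->
  {ae PX, forall w, \forall N \near \oo, forall s : branches N, `|energies w s i| < M i}.
Proof.
move=> hM.
pose B (j : 'I_n) : set R := if j == i then [set x | M i <= `|x|] else setT.
have cB j : closed (B j).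
  rewrite /B; case: eqP => _; last exact: closedT.
  have -> : [set x : R | M i <= `|x|] = (fun x : R => `|x|) @^-1` `[M i, +oo[%classic.
    by apply/seteqP; split => x /=; rewrite in_itv/= andbT.
  apply: preimage_closed; last exact: interval_closed.
  by move=> x _; exact: (@norm_continuous _ R x).
have mB j : measurable (B j) by exact: closed_measurable.
have hJ : ((\sum_(j < n | (j <= i)%N) h j)%:E < \sum_(j < n | (j <= i)%N) inf_rate I B j)%E.
  apply: (@lt_le_trans _ _ (\sum_(j < n) h j + 1)%:E).
    rewrite lte_fin [X in X + 1](bigID (fun j : 'I_n => (j <= i)%N))/= -addrA ltrDl.
    by rewrite ltr_wpDl// sumr_ge0// => j _; apply/ltW/entropy_gt0.
  apply: (@le_trans _ _ (inf_rate I B i)); last first.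
    by rewrite (bigD1 i)//= leeDl// sume_ge0// => j _; exact/inf_rate_ge0/(rate_ge0 hI_ldp).
  apply: le_ereal_inf_tmp => _ [x Bx <-]; rewrite leNgt; apply/negP => /ltW /hM.
  by move: Bx; rewrite /B eqxx /= leNgt => /negP.
have := cell_dead hxi_sym hxi_indep hxi_law hI_ldp hl mB cB hJ.
apply: filterS => w; apply: filterS => N; rewrite num_occ_count_in /count_in => /eqP.
rewrite psumr_eq0// => /allP h0 s; rewrite ltNge; apply/negP => Ms.
have := h0 s (mem_index_enum _); rewrite asboolT ?oner_eq0// => j.
by rewrite /B; case: eqP => [->|].
Qed.

(** Countably many cells, so the null set can be chosen for all meshes at
    once. *)
Lemma ae_cells (M : R) : {ae PX, forall w, forall m,
  [/\ dead_cells I p M (energies w) m, alive_cells I p M (energies w) m &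
      open_cells I p M (energies w) m]}.
Proof.
apply: ae_foralln => m.
have mc (c : {ffun 'I_n -> 'I_(grid_size M m)}) i : measurable (closed_cell c i).
  exact: closed_measurable (@closed_cell_closed _ _ _ _ c i).
have mo (c : {ffun 'I_n -> 'I_(grid_size M m)}) i : measurable (open_cell c i).
  exact: open_measurable (@open_cell_open _ _ _ _ c i).
have m0 : 0 < mesh R m by exact: mesh_gt0.
have h1 : {ae PX, forall w, dead_cells I p M (energies w) m}.
  apply: filter_forall => c; apply: filter_forall => k; apply: ae_imply => hk.
  have := cell_dead hxi_sym hxi_indep hxi_law hI_ldp hl (mc c) (@closed_cell_closed _ _ _ _ c) hk.
  by apply: filterS => w; apply: filterS => N; rewrite num_occ_count_in.
have h2 : {ae PX, forall w, alive_cells I p M (energies w) m}.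
  apply: filter_forall => c; apply: ae_imply => Jf.
  have := cell_alive hxi_sym hxi_indep hxi_law hI_ldp hl (mc c) (@closed_cell_closed _ _ _ _ c)
    (fun i => esym (fineK (Jf i))) m0.
  by apply: filterS => w; apply: filterS => N; rewrite num_occ_count_in.
have h3 : {ae PX, forall w, open_cells I p M (energies w) m}.
  apply: filter_forall => c; apply: ae_imply => Jf; apply: ae_imply => hk.
  have := cell_open hxi_sym hxi_indep hxi_law hI_ldp hl (mo c) (@open_cell_open _ _ _ _ c)
    (fun i => esym (fineK (Jf i))) m0 hk.
  by apply: filterS => w; apply: filterS => N; rewrite num_occ_count_in.
by move: h1 h2 h3; apply: filterS3 => w; split.
Qed.

Hypothesis hI_good : forall i, good (I i).
Hypothesis hI_sqc : forall i, strictly_quasi_convex (I i).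
Context (a : 'I_n -> R).
Hypothesis ha : forall i, 0 < a i.

Lemma partition_functionE w beta N : (0 < N)%N ->
  partition_function a (fun s => xi N s w) (fun i => l i N) beta =
  partition_sum a beta (energies w) N.
Proof.
move=> N0; apply: eq_bigr => s _; congr expR.
rewrite /hamiltonian !mulr_sumr; apply: eq_bigr => i _; rewrite /energies.
have N1 : N%:R != 0 :> R by rewrite pnatr_eq0 -lt0n.
by field.
Qed.

Lemma quenched_limit : {ae PX, forall wX : OmegaX, forall beta : R, 0 < beta ->
      (fun N : nat =>
         (N%:R^-1 * ln (partition_function a (fun s => xi N s wX)
                          (fun i => l i N) beta))%:E) @ \oo -->
      ((\sum_(i < n) h i)%:E - ereal_inf (objective_values I p a beta))%E}.
Proof.
have I0 := rate_ge0 hI_ldp.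
have /choice[x0 hx0] i : exists x, I i x = 0%E.
  exact: good_rate_zero (hI_ldp (size_nseq i.+1 0%N)) (@hI_good i).
have /choice[M hM] i : exists M : R, 0 < M /\
    forall x, (I i x <= (\sum_(j < n) h j + 1)%:E)%E -> `|x| < M.
  by have [M] := good_bounded (\sum_(j < n) h j + 1) (@hI_good i); exists M.
pose Mx := \sum_(i < n) M i.
have MMx i : M i <= Mx.
  by rewrite /Mx (bigD1 i)//= lerDl sumr_ge0// => j _; apply: ltW; case: (hM j).
have h1 : {ae PX, forall w, forall i, \forall N \near \oo,
    forall s : branches N, `|energies w s i| < M i}.
  by apply: filter_forall => i; apply: ae_energies_confined; case: (hM i).
move: h1 (ae_cells Mx); apply: filterS2 => w hc hm beta b0.
apply: (@cvg_trans _ ((fun N : nat =>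
  (N%:R^-1 * ln (partition_sum a beta (energies w) N))%:E) @ \oo)).
  apply: near_eq_cvg; near=> N; rewrite partition_functionE//.
  by near: N; exact: nbhs_infty_gt.
apply: (partition_limit I0 hI_good hI_sqc hp ha b0 hx0 (M := Mx)).
- move=> i x Ix; apply/ltW/(lt_le_trans _ (MMx i)); apply: (hM i).2.
  by apply: le_trans Ix _; rewrite lee_fin lerDl.
- near=> N => s i; apply/ltW/(lt_le_trans _ (MMx i)); move: i s; near: N.
  exact: filter_forall.
- by move=> m; case: (hm m).
- by move=> m; case: (hm m).
- by move=> m; case: (hm m).
Unshelve. all: by end_near. Qed.

End Quenched.

(** * The limit for almost every tree sequence *)

Lemma sum_proportions (R : realType) n (k : 'I_n -> nat -> nat) (p : 'I_n -> R) :
  (forall N : nat, (n <= N)%N -> (\sum_(i < n) k i N)%N = N) ->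
  (forall i, (fun N : nat => (k i N)%:R / N%:R : R) @ \oo --> p i) ->
  \sum_(i < n) p i = 1.
Proof.
move=> hk hkp.
have h1 : (fun N : nat => \sum_(i < n) ((k i N)%:R / N%:R : R)) @ \oo --> \sum_(i < n) p i.
  by apply: cvg_big => [|i _]; [exact: add_continuous|exact: hkp].
have h2 : (fun N : nat => \sum_(i < n) ((k i N)%:R / N%:R : R)) @ \oo --> (1 : R).
  apply: (@cvg_trans _ ((fun _ : nat => 1 : R) @ \oo)); last exact: cvg_cst.
  apply: near_eq_cvg; near=> N.
  rewrite /= -mulr_suml -natr_sum hk; last by near: N; exact: nbhs_infty_ge.
  by rewrite divff// pnatr_eq0 -lt0n; near: N; exact: nbhs_infty_gt.
by rewrite -(cvg_lim _ h1)//; apply: cvg_lim h2.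
Unshelve. all: by end_near. Qed.

Unset Implicit Arguments.
Set Strict Implicit.
Set Printing Implicit Defensive.

Theorem theorem3p1p2 (R : realType) (n : nat) (hn : (1 <= n)%N)
  (k : 'I_n -> nat -> nat)
  (hk_pos : forall (N : nat) (i : 'I_n), (n <= N)%N -> (0 < k i N)%N)
  (hk_sum : forall N : nat, (n <= N)%N -> (\sum_(i < n) k i N)%N = N)
  (a p : 'I_n -> R)
  (ha : forall i, 0 < a i)
  (hp : forall i, 0 < p i)
  (hkp : forall i, (fun N : nat => (k i N)%:R / N%:R : R) @ \oo --> p i)
  (* the trees *)
  (dT : measure_display) (OmegaT : measurableType dT)
  (PT : probability OmegaT R)
  (L : 'I_n -> nat -> {RV PT >-> nat})
  (hL_law : forall (N : nat) (i : 'I_n), (n <= N)%N ->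
     poisson_rv (L i N) (2 ^+ k i N))
  (hL_indep : forall N : nat, (n <= N)%N ->
     mutually_independent setT (fun i : 'I_n => L i N))
  (* the energies attached to the nodes, independent of the trees *)
  (dX : measure_display) (OmegaX : measurableType dX)
  (PX : probability OmegaX R)
  (xi : nat -> seq nat -> {RV PX >-> R})
  (hxi_sym : forall (N : nat) (s : seq nat), (n <= N)%N ->
     (0 < size s <= n)%N -> symmetric_rv (xi N s))
  (hxi_indep : forall N : nat, (n <= N)%N ->
     mutually_independent [set s : seq nat | (0 < size s <= n)%N] (xi N))
  (hxi_law : forall (N : nat) (s t : seq nat), (n <= N)%N ->
     (0 < size s <= n)%N -> size t = size s -> same_law (xi N s) (xi N t))
  (* the rate functions *)
  (I : 'I_n -> R -> \bar R)
  (hI_good : forall i, good (I i))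
  (hI_sqc : forall i, strictly_quasi_convex (I i))
  (hI_ldp : forall (i : 'I_n) (s : seq nat), size s = i.+1 ->
     ldp (fun N : nat =>
       distribution PX (measurable_realfun.scale_mfun N%:R^-1 (xi N s)))
       (I i)) :
  {ae PT, forall wT : OmegaT, {ae PX, forall wX : OmegaX,
    forall beta : R, 0 < beta ->
      (fun N : nat =>
         (N%:R^-1 * ln (partition_function a (fun s => xi N s wX)
                          (fun i => L i N wT) beta))%:E) @ \oo -->
      ((ln 2)%:E -
        ereal_inf [set \sum_(i < n) (I i (x ord0 i) - (beta * a i * x ord0 i)%:E)
                  | x in Psi p I])%E}}.
Proof.
have p1 := sum_proportions hk_sum hkp.
have growth : {ae PT, forall wT, forall i (e : R), 0 < e -> \forall N \near \oo,
    expR ((p i * ln 2 - e) * N%:R) <= (L i N wT).+1%:R <= expR ((p i * ln 2 + e) * N%:R)}.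
  apply: filter_forall => i.
  by apply: (@ae_poisson_growth _ _ _ PT (k i) (p i) (L i) n (hp i) (hkp i)) => N; exact: hL_law.
apply: filterS growth => wT hl.
have := quenched_limit hxi_sym hxi_indep hxi_law hI_ldp hp hl hI_good hI_sqc ha.
by rewrite -mulr_suml p1 mul1r.
Qed.
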